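(* Let $\bar A\in\{0,\star\}^{n\times n}$ be a given structural matrix, and let $\mathbb I_n\in\{0,\star\}^{n\times n}$ be the structural diagonal matrix with all diagonal entries equal to $\star$ and all off-diagonal entries equal to $0$. The problem (minimum dedicated input selection problem) of determining $$\mathcal J^*\in\arg\min_{\mathcal J\subseteq\{1,\ldots,n\}}|\mathcal J|\quad\text{subject to}\quad(\bar A,\mathbb I_n(\mathcal J))\text{ is structurally controllable}$$ can be solved in polynomial time; more precisely, in $\mathcal O(n^3)$.
   Context: A structural matrix is a matrix with entries in $\{0,\star\}$, where $0$ denotes a fixed zero and $\star$ a free parameter. A numerical realization of a structural matrix $\bar M\in\{0,\star\}^{a\times b}$ is a real matrix $M\in\mathbb R^{a\times b}$ with $M_{i,j}=0$ whenever $\bar M_{i,j}=0$ (the entries at $\star$ positions are arbitrary real numbers). A pair $(\bar A,\bar B)$ with $\bar A\in\{0,\star\}^{n\times n}$, $\bar B\in\{0,\star\}^{n\times p}$ is structurally controllable if there exist numerical realizations $A$ of $\bar A$ and $B$ of $\bar B$ such that the linear time-invariant system $\dot x(t)=Ax(t)+Bu(t)$ is controllable. $\mathbb I_n(\mathcal J)$ denotes the submatrix of $\mathbb I_n$ formed by the columns with index in $\mathcal J$. Complexity is measured as the number of elementary operations, as a function of $n$. *)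

(* Defs.v *)
From HB Require Import structures.
From mathcomp Require Import all_boot all_order all_algebra.
From mathcomp Require Import all_classical all_reals all_analysis.
Set Implicit Arguments.
Unset Strict Implicit.
Unset Printing Implicit Defensive.
Import Order.TTheory GRing.Theory Num.Theory.
Import numFieldNormedType.Exports.

Local Open Scope classical_set_scope.
Local Open Scope ring_scope.

(* Inputs are continuous and [x] is a classical solution of the state equation
   on [0, T].  Continuity and derivatives are taken entrywise, since [p] (and
   [n]) may be 0; values outside [0, T] are irrelevant. *)
Definition lti_trajectory (R : realType) (n p : nat)
    (A : 'M[R]_n) (B : 'M[R]_(n, p)) (T : R)
    (u : R -> 'cV[R]_p) (x : R -> 'cV[R]_n) : Prop :=
  [/\ forall k : 'I_p, {within `[0, T], continuous (fun t : R => u t k 0)},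
      forall i : 'I_n, {within `[0, T], continuous (fun t : R => x t i 0)} &
      forall (t : R) (i : 'I_n), 0 < t < T ->
        is_derive t 1 (fun s : R => x s i 0) ((A *m x t + B *m u t) i 0)].

Definition controllable (R : realType) (n p : nat)
    (A : 'M[R]_n) (B : 'M[R]_(n, p)) : Prop :=
  forall x0 x1 : 'cV[R]_n, exists2 T : R, 0 < T &
    exists (u : R -> 'cV[R]_p) (x : R -> 'cV[R]_n),
      [/\ lti_trajectory A B T u x, x 0 = x0 & x T = x1].

(* [true] is the free parameter, [false] the fixed zero. *)
Definition structural_matrix (a b : nat) : Type := 'M[bool]_(a, b).

Definition realization (R : realType) (a b : nat)
    (Mbar : structural_matrix a b) (M : 'M[R]_(a, b)) : Prop :=
  forall i j, Mbar i j = false -> M i j = 0.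

Definition structurally_controllable (R : realType) (n p : nat)
    (Abar : structural_matrix n n) (Bbar : structural_matrix n p) : Prop :=
  exists (A : 'M[R]_n) (B : 'M[R]_(n, p)),
    [/\ realization Abar A, realization Bbar B & controllable A B].

Definition structural_id (n : nat) : structural_matrix n n :=
  \matrix_(i, j) (i == j).

Definition structural_id_cols (n : nat) (J : {set 'I_n}) :
    structural_matrix n #|J| :=
  colsub (fun k : 'I_#|J| => enum_val k) (structural_id n).

Definition dedicated_feasible (R : realType) (n : nat)
    (Abar : structural_matrix n n) (J : {set 'I_n}) : Prop :=
  structurally_controllable R Abar (structural_id_cols J).

Definition min_dedicated_input (R : realType) (n : nat)
    (Abar : structural_matrix n n) (J : {set 'I_n}) : Prop :=
  dedicated_feasible R Abar J /\
  forall J' : {set 'I_n}, dedicated_feasible R Abar J' -> (#|J| <= #|J'|)%N.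

Local Open Scope nat_scope.

(* Random-access machine with unit-cost elementary operations, presented as a
   structured programming language.  There is no multiplication: with only
   additive arithmetic, the unit-cost measure on unbounded integers is
   polynomially related to Turing machine time. *)
Inductive expr : Type :=
| EConst of nat
| EReg of nat
| EMem of expr
| EAdd of expr & expr
| ESub of expr & expr
| ELt of expr & expr
| EEq of expr & expr.

Inductive cmd : Type :=
| CSkip
| CSetReg of nat & expr
| CSetMem of expr & expr
| CSeq of cmd & cmd
| CIf of expr & cmd & cmd
| CWhile of expr & cmd.

Record state : Type := State { regs : nat -> nat; memory : nat -> nat }.

Definition upd (f : nat -> nat) (a v : nat) : nat -> nat :=
  fun b => if b == a then v else f b.

Fixpoint eval (s : state) (e : expr) : nat :=
  match e with
  | EConst c => c
  | EReg r => regs s r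
  | EMem e1 => memory s (eval s e1)
  | EAdd e1 e2 => eval s e1 + eval s e2
  | ESub e1 e2 => eval s e1 - eval s e2
  | ELt e1 e2 => eval s e1 < eval s e2
  | EEq e1 e2 => eval s e1 == eval s e2
  end.

Fixpoint expr_cost (e : expr) : nat :=
  match e with
  | EConst _ | EReg _ => 1
  | EMem e1 => (expr_cost e1).+1
  | EAdd e1 e2 | ESub e1 e2 | ELt e1 e2 | EEq e1 e2 =>
      (expr_cost e1 + expr_cost e2).+1
  end.

(* [exec c s t s']: started in [s], the program [c] halts in [s'] after exactly
   [t] elementary operations.  Tests succeed on nonzero values. *)
Inductive exec : cmd -> state -> nat -> state -> Prop :=
| exec_skip s : exec CSkip s 1 s
| exec_setreg r e s :
    exec (CSetReg r e) s (expr_cost e).+1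
      (State (upd (regs s) r (eval s e)) (memory s))
| exec_setmem e1 e2 s :
    exec (CSetMem e1 e2) s (expr_cost e1 + expr_cost e2).+1
      (State (regs s) (upd (memory s) (eval s e1) (eval s e2)))
| exec_seq c1 c2 s s1 s2 t1 t2 :
    exec c1 s t1 s1 -> exec c2 s1 t2 s2 -> exec (CSeq c1 c2) s (t1 + t2) s2
| exec_if e c1 c2 s s1 t :
    exec (if eval s e != 0 then c1 else c2) s t s1 ->
    exec (CIf e c1 c2) s (expr_cost e + t).+1 s1
| exec_while_stop e c s :
    eval s e = 0 -> exec (CWhile e c) s (expr_cost e).+1 s
| exec_while_step e c s s1 s2 t1 t2 :
    eval s e <> 0 -> exec c s t1 s1 -> exec (CWhile e c) s1 t2 s2 ->
    exec (CWhile e c) s (expr_cost e + t1 + t2).+1 s2.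

(* The dimension is in register 0 and the matrix is stored in row-major order
   from address 0; everything else is 0. *)
Definition input_state (n : nat) (Abar : structural_matrix n n) (s : state) :
    Prop :=
  [/\ regs s 0 = n, forall r, r != 0 -> regs s r = 0,
      forall i j : 'I_n, memory s (i * n + j) = Abar i j &
      forall a, n * n <= a -> memory s a = 0].

(* A set of indices is returned as its characteristic vector, from address 0. *)
Definition output_state (n : nat) (J : {set 'I_n}) (s : state) : Prop :=
  forall j : 'I_n, memory s j = (j \in J).

Definition is_bigO (T f : nat -> nat) : Prop :=
  exists C N, forall n, N <= n -> T n <= C * f n.

(* [P] is a problem with input a square structural matrix and output a set of
   indices; a single program handles all dimensions. *)
Definition solvable_in_time
    (P : forall n, structural_matrix n n -> {set 'I_n} -> Prop)
    (f : nat -> nat) : Prop :=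
  exists (c : cmd) (T : nat -> nat), is_bigO T f /\
    forall n (Abar : structural_matrix n n) s, input_state Abar s ->
      exists t s' (J : {set 'I_n}),
        [/\ exec c s t s', t <= T n, output_state J s' & P n Abar J].

(* Main.v *)
Require Import Defs.
From HB Require Import structures.
From mathcomp Require Import all_boot all_order all_algebra.
From mathcomp Require Import all_fingroup.
From mathcomp Require Import all_classical all_reals all_analysis.
From mathcomp Require Import ring lra zify.
Import Defs.
Set Implicit Arguments.
Unset Strict Implicit.
Unset Printing Implicit Defensive.
Import Order.TTheory GRing.Theory Num.Theory.
Import numFieldNormedType.Exports.

(* A set J of dedicated inputs is feasible iff (a) every state is reached from J
   along the graph of Abar and (b) the rows outside J can be matched injectively
   to columns of Abar.

   Necessity: linear functionals of the state whose span is invariant under A and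
   annihilated by B cannot be moved by the input (a Gronwall estimate).  The
   coordinates that J does not reach are such functionals, and so is the left
   kernel of [A B]; when the latter is zero, a maximal minor has a nonzero term.

   Sufficiency: the matching splits the states into paths issued from J and
   cycles.  Start with the paths and add the cycles one at a time, each entered
   through a single edge.  Modulo the Krylov space, the basis vector at the entry
   of the cycle is killed by a nonzero polynomial g that does not depend on the
   weight a of the cycle, and by X^k - a^k, which is coprime to g for a large.

   Optimization: adjoin to the bipartite graph of Abar one column per strongly
   connected component that no other component influences, adjacent to the
   vertices it reaches.  If there are b such components and a maximum matching has
   size mu, the optimum is n - mu + b.  Warshall's closure finds the components.
   The matching comes from an auction: a free row takes its cheapest adjacent
   column, raises its price by one and evicts the previous owner, and gives up at
   price n + 1.  There are O(n^2) bids of cost O(n) each. *)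

Local Open Scope ring_scope.

(** * Steering with polynomial trajectories *)

(** The smallest [A]-invariant submodule containing the image of [B]; over a field, the range of the
    Kalman matrix. The inductive form allows recursion on the way a vector is generated. *)
Inductive krylov (R : nzRingType) (n p : nat) (A : 'M[R]_n) (B : 'M[R]_(n, p)) :
    'cV[R]_n -> Prop :=
| krylov_input y : krylov A B (B *m y)
| krylov_mul x : krylov A B x -> krylov A B (A *m x)
| krylov_lin a x y : krylov A B x -> krylov A B y -> krylov A B (a *: x + y).

Section PolynomialTrajectories.
Variable R : numFieldType.
Local Notation "M ^P" := (map_mx (@polyC R) M) (at level 2, format "M ^P").
Local Notation "z ^'D" := (map_mx (@deriv R) z) (at level 2, format "z ^'D").

Lemma map_derivD (a b : nat) (M N : 'M[{poly R}]_(a, b)) :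
  (M + N)^'D = M^'D + N^'D.
Proof. by apply/matrixP => i j; rewrite !mxE derivD. Qed.

Lemma map_deriv_scale (a b : nat) (q : {poly R}) (M : 'M[{poly R}]_(a, b)) :
  (q *: M)^'D = q^`() *: M + q *: M^'D.
Proof. by apply/matrixP => i j; rewrite !mxE derivM. Qed.

Lemma map_derivC (a b : nat) (M : 'M[R]_(a, b)) : M^P^'D = 0.
Proof. by apply/matrixP => i j; rewrite !mxE derivC. Qed.

Lemma dvdp_XsubC_exp_deriv (a : R) (m : nat) (p : {poly R}) :
  ('X - a%:P) ^+ m.+1 %| p -> ('X - a%:P) ^+ m %| p^`().
Proof.
case/dvdpP => q ->; rewrite derivM deriv_exp derivXsubC mul1r /=.
rewrite dvdp_add //.
  by rewrite exprS mulrA dvdp_mull.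
by rewrite mulrnAr -mulrnAl dvdp_mull.
Qed.

Lemma dvdp_XsubC_exp_root (a : R) (m : nat) (p : {poly R}) :
  ('X - a%:P) ^+ m.+1 %| p -> p.[a] = 0.
Proof. by case/dvdpP => q ->; rewrite hornerM horner_exp hornerXsubC subrr expr0n mulr0. Qed.

Variables (n p : nat) (A : 'M[R]_n) (B : 'M[R]_(n, p)).

(* A forcing term [q x] can be traded for an input by adding to the state a
   correction [w] depending on finitely many derivatives of [q]. *)
Lemma krylov_correction (x : 'cV[R]_n) : krylov A B x ->
  exists N, forall q : {poly R}, exists w u,
    w^'D - A^P *m w = B^P *m u - q *: x^P /\
    forall a, ('X - a%:P) ^+ N %| q -> forall i, (w i 0).[a] = 0.
Proof.
elim=> {x} [y|x _ [N IH]|c x y _ [N1 IH1] _ [N2 IH2]].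
- exists 0%N => q; exists 0, (q *: y^P); split; last first.
    by move=> a _ i; rewrite mxE horner0.
  rewrite mulmx0 subr0 -scalemxAr -map_mxM /= subrr.
  by apply/matrixP => i j; rewrite !mxE deriv0.
(* Adding [q *: x] to the correction for the derivative of [q] cancels the old forcing and leaves
   [- q *: (A *m x)]. Differentiation costs one order of vanishing, hence [N.+1]. *)
- exists N.+1 => q; have [w [u [wE w0]]] := IH q^`().
  exists (w + q *: x^P), u; split; last first.
    move=> a aq i; rewrite !mxE hornerD hornerM w0; last first.
      exact: dvdp_XsubC_exp_deriv.
    by rewrite (dvdp_XsubC_exp_root aq) mul0r addr0.
  rewrite map_derivD map_deriv_scale map_derivC scaler0 addr0 mulmxDr.
  rewrite -scalemxAr -map_mxM opprD addrACA [X in X + _ = _]wE.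
  by rewrite addrA subrK.
exists (N1 + N2)%N => q.
have [w1 [u1 [wE1 w01]]] := IH1 (c *: q); have [w2 [u2 [wE2 w02]]] := IH2 q.
exists (w1 + w2), (u1 + u2); split; last first.
  move=> a aq i; rewrite !mxE hornerD w01 ?w02 ?addr0 //.
    by apply: dvdp_trans aq; rewrite exprD dvdp_mull.
  rewrite -mul_polyC dvdp_mull //.
  by apply: dvdp_trans aq; rewrite exprD dvdp_mulr.
rewrite map_derivD !mulmxDr opprD addrACA wE1 wE2.
rewrite addrACA -opprD; congr (_ - _).
apply/matrixP => i j; rewrite !mxE polyCD polyCM -mul_polyC; ring.
Qed.

(** Truncated power series solution of the homogeneous equation at [a]: when the residual is
    [X ^+ N *: q], subtracting [X ^+ N.+1] over [N.+1] times the value of [q] at [a] removes its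
    leading term. *)
Lemma flat_start (a : R) (x0 : 'cV[R]_n) (N : nat) :
  exists z : 'cV[{poly R}]_n, (forall i, (z i 0).[a] = x0 i 0) /\
    forall i, ('X - a%:P) ^+ N %| (z^'D - A^P *m z) i 0.
Proof.
elim: N => [|N [z [za zd]]].
  exists x0^P; split => i; first by rewrite mxE hornerC.
  by rewrite expr0 dvd1p.
set X := 'X - a%:P in zd *.
pose e : 'cV[{poly R}]_n := z^'D - A^P *m z.
pose q : 'cV[{poly R}]_n := \col_i (e i 0 %/ X ^+ N).
have eE : e = X ^+ N *: q.
  apply/matrixP => i j; rewrite (ord1 j) [RHS]mxE [q _ _]mxE mulrC.
  by apply/eqP; have := zd i; rewrite -/e dvdp_eq.
pose c : 'cV[R]_n := \col_i (q i 0).[a].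
pose h := (N.+1%:R^-1 *: X ^+ N.+1 : {poly R}).
have hd : h^`() = X ^+ N.
  rewrite derivZ deriv_exp derivXsubC mul1r /= -[X ^+ N *+ _]scaler_nat scalerA.
  by rewrite mulVf ?scale1r // pnatr_eq0.
exists (z - h *: c^P); split=> i.
  rewrite !mxE hornerD hornerN za hornerM hornerZ horner_exp hornerXsubC.
  by rewrite subrr expr0n mulr0 mul0r subr0.
have -> : (z - h *: c^P)^'D - A^P *m (z - h *: c^P)
    = X ^+ N *: (q - c^P) + h *: (A^P *m c^P).
  rewrite -[- (h *: _)]scaleNr map_derivD map_deriv_scale map_derivC scaler0.
  rewrite addr0 derivN hd mulmxDr opprD addrACA -/e eE -scalemxAr.
  by apply/matrixP => k l; rewrite !mxE; ring.
rewrite [X in _ %| X]mxE dvdp_add //; last first.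
  by rewrite [X in _ %| X]mxE dvdp_mulr // dvdpZr ?invr_eq0 ?pnatr_eq0.
rewrite !mxE exprSr dvdp_mul // /X dvdp_XsubCl /root hornerD hornerN hornerC.
by rewrite subrr.
Qed.

(** Two local solutions are glued by a partition of unity [b0 + b1 = 1] coming from Bezout. The
    exponent [N.+1] leaves order [N] for the derivatives, which are opposite to each other, so both
    ends stay flat. *)
Lemma flat_join (N : nat) (x0 x1 : 'cV[R]_n) :
  exists z : 'cV[{poly R}]_n,
    [/\ forall i, (z i 0).[0] = x0 i 0, forall i, (z i 0).[1] = x1 i 0 &
        forall i, ('X - 0%:P) ^+ N %| (z^'D - A^P *m z) i 0 /\
                  ('X - 1%:P) ^+ N %| (z^'D - A^P *m z) i 0].
Proof.
have [z0 [z00 z0d]] := flat_start 0 x0 N.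
have [z1 [z11 z1d]] := flat_start 1 x1 N.
have cop : coprimep (('X - 0%:P : {poly R}) ^+ N.+1) (('X - 1%:P) ^+ N.+1).
  apply: coprimep_expl; apply: coprimep_expr; rewrite coprimep_XsubC.
  by rewrite /root hornerXsubC subr0 oner_eq0.
have [[s r] /= srE] := Bezout_eq1_coprimepP _ _ cop.
pose b0 := s * ('X - 0%:P) ^+ N.+1; pose b1 := r * ('X - 1%:P) ^+ N.+1.
have bE : b0 + b1 = 1 by [].
have b0_0 : b0.[0] = 0 by apply: (@dvdp_XsubC_exp_root _ N); rewrite dvdp_mull.
have b1_1 : b1.[1] = 0 by apply: (@dvdp_XsubC_exp_root _ N); rewrite dvdp_mull.
have b1_0 : b1.[0] = 1 by rewrite -[LHS]add0r -{1}b0_0 -hornerD bE hornerC.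
have b0_1 : b0.[1] = 1 by rewrite -[LHS]addr0 -{1}b1_1 -hornerD bE hornerC.
have dE : b0^`() = - b1^`().
  by apply/eqP; rewrite -subr_eq0 opprK -derivD bE -polyC1 derivC.
have b0d : ('X - 0%:P) ^+ N %| b0^`().
  by apply: dvdp_XsubC_exp_deriv; rewrite dvdp_mull.
have b1d : ('X - 1%:P) ^+ N %| b1^`().
  by apply: dvdp_XsubC_exp_deriv; rewrite dvdp_mull.
have b0N : ('X - 0%:P) ^+ N %| b0 by rewrite /b0 exprS mulrA dvdp_mull.
have b1N : ('X - 1%:P) ^+ N %| b1 by rewrite /b1 exprS mulrA dvdp_mull.
clearbody b0 b1; exists (b1 *: z0 + b0 *: z1); split => i.
- by rewrite !mxE hornerD !hornerM b1_0 b0_0 mul1r mul0r addr0.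
- by rewrite !mxE hornerD !hornerM b1_1 b0_1 mul1r mul0r add0r.
have -> : (b1 *: z0 + b0 *: z1)^'D - A^P *m (b1 *: z0 + b0 *: z1) =
    b1 *: (z0^'D - A^P *m z0) + b0 *: (z1^'D - A^P *m z1)
    + (b1^`() *: z0 + b0^`() *: z1).
  rewrite map_derivD !map_deriv_scale mulmxDr -!scalemxAr !scalerBr.
  rewrite opprD; set u1 := _ *: z0; set u2 := _ *: z1.
  by apply/matrixP => k l; rewrite !mxE; ring.
move: (z0^'D - _) (z1^'D - _) z0d z1d => d0 d1 d0_dvd d1_dvd.
rewrite !mxE; split.
  by rewrite !dvdp_add ?(dvdp_mulr _ b0N) ?(dvdp_mulr _ b0d) ?(dvdp_mull _ (d0_dvd i))
    // -[b1^`()]opprK -dE mulNr dvdpNr dvdp_mulr.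
by rewrite !dvdp_add ?(dvdp_mulr _ b1N) ?(dvdp_mulr _ b1d) ?(dvdp_mull _ (d1_dvd i))
  // dE mulNr dvdpNr dvdp_mulr.
Qed.

(** The residual [v] of a curve joining the endpoints is split along the basis vectors, and each
    component is traded for an input. As [v] is flat at 0 and 1, the corrections vanish there and
    keep the endpoints. *)
Lemma polynomial_steering (x0 x1 : 'cV[R]_n) : (forall x, krylov A B x) ->
  exists (x : 'cV[{poly R}]_n) (u : 'cV[{poly R}]_p), [/\ x^'D = A^P *m x + B^P *m u,
    forall i, (x i 0).[0] = x0 i 0 & forall i, (x i 0).[1] = x1 i 0].
Proof.
move=> K; pose e i : 'cV[R]_n := delta_mx i 0.
have [N HN] := fin_all_exists (fun i => krylov_correction (K (e i))).
pose M := (\sum_i N i)%N.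
have [z [z0 z1 zd]] := flat_join M x0 x1.
set v := z^'D - A^P *m z in zd.
have [w Hw] := fin_all_exists (fun i => HN i (v i 0)).
have [u Hu] := fin_all_exists Hw => {Hw}.
have NM i : (N i <= M)%N by rewrite /M (bigD1 i) //= leq_addr.
have w0 a i : (a == 0) || (a == 1) -> (\sum_j w j i 0).[a] = 0.
  move=> a01; rewrite horner_sum big1 // => j _; apply: (Hu j).2.
  apply: dvdp_trans (_ : ('X - a%:P) ^+ M %| _); first by rewrite dvdp_exp2l.
  by case/orP: a01 => /eqP ->; case: (zd j).
exists (z + \sum_j w j), (\sum_j u j); split; last first.
- by move=> i; rewrite mxE summxE hornerD w0 ?eqxx ?orbT // addr0.
- by move=> i; rewrite mxE summxE hornerD w0 ?eqxx // addr0.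
apply/eqP; rewrite [X in _ == X]addrC -subr_eq map_derivD mulmxDr opprD addrACA.
rewrite -/v.
have -> : (\sum_j w j)^'D - A^P *m (\sum_j w j) = \sum_j ((w j)^'D - A^P *m w j).
  rewrite sumrB mulmx_sumr; congr (_ - _).
  by apply/matrixP => i j; rewrite mxE !summxE raddf_sum; apply: eq_bigr => k _; rewrite mxE.
rewrite (eq_bigr (fun j => B^P *m u j - v j 0 *: (e j)^P)); last first.
  by move=> j _; exact: (Hu j).1.
rewrite sumrB mulmx_sumr addrCA -[X in _ == X]addr0; apply/eqP; congr (_ + _).
apply/eqP; rewrite subr_eq0; apply/eqP/matrixP => i j; rewrite (ord1 j) summxE.
rewrite (bigD1 i) //= big1 => [|k ki]; rewrite !mxE eqxx ?mulr1 ?addr0 //.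
by rewrite eq_sym (negbTE ki) /= polyC0 mulr0.
Qed.

End PolynomialTrajectories.

Lemma krylov_controllable (R : realType) (n p : nat)
    (A : 'M[R]_n) (B : 'M[R]_(n, p)) :
  (forall x, krylov A B x) -> controllable A B.
Proof.
move=> K x0 x1; exists 1 => //.
have [x [u [xE x_0 x_1]]] := polynomial_steering x0 x1 K.
have ev (t : R) (a b : nat) (M : 'M[R]_(a, b)) (y : 'cV[{poly R}]_b) i :
  ((map_mx (@polyC R) M *m y) i 0).[t] = (M *m map_mx (horner^~ t) y) i 0.
  by rewrite !mxE horner_sum; apply: eq_bigr => k _; rewrite hornerM !mxE hornerC.
exists (fun t => map_mx (horner^~ t) u), (fun t => map_mx (horner^~ t) x).
split; last 2 first.
- by apply/matrixP => i j; rewrite (ord1 j) mxE x_0.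
- by apply/matrixP => i j; rewrite (ord1 j) mxE x_1.
split=> [k|i|t i _].
- apply: continuous_subspaceT; rewrite (_ : (fun _ => _) = horner (u k 0)).
    exact: continuous_horner.
  by apply/funext => t; rewrite mxE.
- apply: continuous_subspaceT; rewrite (_ : (fun _ => _) = horner (x i 0)).
    exact: continuous_horner.
  by apply/funext => t; rewrite mxE.
rewrite (_ : (fun _ => _) = horner (x i 0)); last by apply/funext => s; rewrite mxE.
apply: is_derive_eq; rewrite [RHS]mxE -!ev -hornerD.
by have /matrixP/(_ i 0) := xE; rewrite !mxE => ->.
Qed.

(** * Invariant row spaces *)

Local Open Scope classical_set_scope.
Local Open Scope ring_scope.

(** The product of [E] with [expR (- c * t)] has nonpositive derivative, so the mean value theorem
    bounds its value at [T] by its value at 0. *)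
Lemma gronwall_le0 (R : realType) (c T : R) (E dE : R -> R) : 0 < T ->
  {within `[0, T], continuous E} ->
  (forall t, 0 < t < T -> is_derive t 1 E (dE t) /\ dE t <= c * E t) ->
  E 0 <= 0 -> E T <= 0.
Proof.
move=> T0 Ec Ed E0.
pose f (t : R) : R := expR (- c * t); pose g : R -> R := f * E.
have df (t : R) : is_derive t 1 f (- c * f t).
  have dl : is_derive t 1 ( *%R (- c)) (- c).
    rewrite (_ : *%R (- c) = - c \*: (@id R)); last exact/funext.
    by apply: is_derive_eq; rewrite scaler1.
  by rewrite [- c * f t]mulrC; exact: is_derive1_comp.
have [||t tT] := @MVT R g (fun t => f t *: dE t + E t *: (- c * f t)) 0 T T0.
- by move=> t; rewrite in_itv /= => tT; have [? _] := Ed t tT; apply: is_deriveM.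
- have fc : {within `[0, T], continuous f}.
    apply: continuous_subspaceT => t.
    by apply/differentiable_continuous/derivable1_diffP; have [] := df t.
  by move=> t; apply: cvgM; [exact: fc | exact: Ec].
have [_ dE_le] : is_derive t 1 E (dE t) /\ dE t <= c * E t.
  by apply: Ed; move: tT; rewrite in_itv.
rewrite subr0 => gE.
have gT : g T <= g 0.
  rewrite -subr_le0 gE pmulr_lle0 //.
  have -> : f t *: dE t + E t *: (- c * f t) = f t * (dE t - c * E t).
    rewrite /GRing.scale /=; ring.
  by rewrite pmulr_rle0 ?expR_gt0 // subr_le0.
have : g T <= 0.
  apply: le_trans gT _.
  by rewrite /g /GRing.mul /= pmulr_rle0 ?expR_gt0.
by rewrite /g /GRing.mul /= pmulr_rle0 ?expR_gt0.
Qed.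

(** Whatever the input, [y = W x] solves [y' = N y], so a trajectory from 0 keeps [y = 0]. Steering
    it to a basis vector annihilates the corresponding column of [W]. *)
Lemma controllable_invariant_rows0 (R : realType) (n p k : nat)
    (A : 'M[R]_n) (B : 'M[R]_(n, p)) (W : 'M[R]_(k, n)) (N : 'M[R]_k) :
  controllable A B -> W *m A = N *m W -> W *m B = 0 -> W = 0.
Proof.
move=> ctl WA WB; apply/matrixP => i0 j0.
have [T T0 [u [x [[_ xc xd] x_0 x_T]]]] := ctl 0 (delta_mx j0 0).
pose y i (t : R) : R := (W *m x t) i 0.
have yc i : {within `[0, T], continuous (y i)}.
  rewrite (_ : y i = fun t => \sum_l W i l * x t l 0); last first.
    by apply/funext => t; rewrite /y mxE.
  move=> t; apply: cvg_big => // [|l _]; first exact: add_continuous.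
  apply: cvgM; first exact: cvg_cst.
  exact: xc.
have yd i (t : R) : 0 < t < T -> is_derive t 1 (y i) (\sum_l N i l * y l t).
  move=> tT.
  have -> : y i = \sum_(l < n) (W i l \*: (fun s => x s l 0)).
    by apply/funext => s; rewrite /y mxE fct_sumE.
  have H l := xd t l tT.
  apply: is_derive_eq.
  transitivity ((W *m (A *m x t + B *m u t)) i 0).
    by rewrite mxE.
  by rewrite mulmxDr !mulmxA WB mul0mx addr0 WA -mulmxA mxE.
pose E := \sum_(i < k) (y i * y i).
have EE t : E t = \sum_(i < k) y i t * y i t by rewrite /E fct_sumE.
(* Each [y i t * y l t] is at most [E t] in absolute value, and differentiating squares contributes
   the factor 2. *)
pose c := \sum_(i < k) \sum_(l < k) (`|N i l| *+ 2).
have sq_le i t : y i t * y i t <= E t.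
  by rewrite EE (bigD1 i) //= lerDl sumr_ge0 // => l _; rewrite -expr2 sqr_ge0.
have E_T : E T <= 0.
  apply: (@gronwall_le0 _ c T E (fun t => \sum_(i < k)
      (y i t *: (\sum_l N i l * y l t) + y i t *: (\sum_l N i l * y l t)))) => //.
  - move=> t; rewrite (_ : E = (fun t => \sum_(i < k) y i t * y i t)); last exact/funext.
    by apply: cvg_big => // [|i _]; first exact: add_continuous; apply: cvgM; exact: yc.
  - move=> t tT; split.
      by have H i := yd i t tT; rewrite /E; apply: is_derive_eq.
    rewrite /c mulr_suml ler_sum // => i _.
    rewrite -mulr2n scaler_sumr mulr_suml -sumrMnl ler_sum // => l _.
    rewrite mulrnAl ler_pMn2r //.
    rewrite [X in X <= _](_ : _ = N i l * (y i t * y l t)); last first.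
      by rewrite /GRing.scale /=; ring.
    apply: le_trans (ler_norm _) _; rewrite normrM ler_wpM2l //.
    rewrite ler_norml; have := sq_le i t; have := sq_le l t.
    have := sqr_ge0 (y i t - y l t); have := sqr_ge0 (y i t + y l t).
    rewrite !expr2; nra.
  by rewrite EE big1 // => i _; rewrite /y x_0 mulmx0 mxE mul0r.
have : y i0 T * y i0 T <= 0 by apply: le_trans (sq_le _ _) E_T.
rewrite -expr2 => yT; have /eqP : y i0 T ^+ 2 == 0 by rewrite eq_le yT sqr_ge0.
move/eqP; rewrite sqrf_eq0 /y x_T -colE !mxE => /eqP ->; by [].
Qed.

Local Close Scope classical_set_scope.

(* [Abar i j] reads "the derivative of [x_i] depends on [x_j]", so information
   flows from [j] to [i]: paths of [Abar] are followed backwards in time. *)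
Definition accessible (n : nat) (Abar : structural_matrix n n) (J : {set 'I_n}) :=
  forall v, exists2 j, j \in J & connect (fun i j => Abar i j) v j.

Definition matched (n : nat) (Abar : structural_matrix n n) (J : {set 'I_n}) :=
  exists2 f : 'I_n -> 'I_n,
    {in ~: J &, injective f} & forall i, i \notin J -> Abar i (f i).

(** * Necessity of the two graph conditions *)

Lemma det_neq0_perm (R : comNzRingType) (n : nat) (M : 'M[R]_n) :
  \det M != 0 -> exists s : 'S_n, forall i, M i (s i) != 0.
Proof.
move=> dM; suff /existsP[s /forallP] : [exists s : 'S_n, [forall i, M i (s i) != 0]].
  by exists s.
apply: contraNT dM; rewrite negb_exists => /forallP H.
apply/eqP; apply: big1 => s _.
have := H s; rewrite negb_forall => /existsP[i]; rewrite negbK => /eqP Mi.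
by rewrite (bigD1 i) //= Mi mul0r mulr0.
Qed.

Lemma structural_id_colsE (n : nat) (J : {set 'I_n}) i k :
  structural_id_cols J i k = (i == enum_val k).
Proof. by rewrite !mxE. Qed.

(** [W] projects onto the coordinates that [J] does not reach. Their rows have no entry in a column
    that [J] reaches, so [W A = W A W], an invariance with [N = W A]; none of them lies in [J], so
    [W B = 0]. *)
Lemma feasible_accessible (R : realType) (n : nat)
    (Abar : structural_matrix n n) (J : {set 'I_n}) :
  dedicated_feasible R Abar J -> accessible Abar J.
Proof.
case=> A [B [rA rB ctl]] v.
pose acc i := [exists j in J, connect (fun i j => Abar i j) i j].
have accP i : reflect (exists2 j, j \in J & connect (fun i j => Abar i j) i j) (acc i).
  exact: exists_inP.
clearbody acc; apply/accP; apply: contraT => vU.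
pose W : 'M[R]_n := \matrix_(i, j) ((i == j) && ~~ acc i)%:R.
have WM (m : nat) (M : 'M[R]_(n, m)) i j : (W *m M) i j = (~~ acc i)%:R * M i j.
  rewrite mxE (bigD1 i) //= big1 => [|k ki]; rewrite !mxE ?eqxx ?addr0 //.
  by rewrite eq_sym (negbTE ki) mul0r.
have W0 : W = 0.
  apply: (@controllable_invariant_rows0 _ _ _ _ A B W (W *m A)) => //.
    apply/matrixP => i j; rewrite [RHS]mxE (bigD1 j) //= big1 ?addr0; last first.
      by move=> k kj; rewrite [W k j]mxE (negbTE kj) mulr0.
    rewrite !WM [W j j]mxE eqxx /=.
    have [|] := boolP (acc j); last by rewrite /= mulr1.
    case/accP => k kJ jk; rewrite mulr0.
    have [|ai] := boolP (acc i); first by rewrite mul0r.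
    rewrite rA ?mulr0 //; apply: contraNF ai => ij.
    by apply/accP; exists k => //; apply: connect_trans jk; apply: connect1.
  apply/matrixP => i k; rewrite WM mxE.
  have [|ai] := boolP (acc i); first by rewrite mul0r.
  rewrite rB ?mulr0 // structural_id_colsE; apply: contraNF ai => /eqP ->.
  by apply/accP; exists (enum_val k); rewrite ?enum_valP.
by have /matrixP/(_ v v)/eqP := W0; rewrite !mxE eqxx vU oner_eq0.
Qed.

(** The left kernel of [[A B]] is invariant with [N = 0], hence vanishes. An invertible maximal
    minor has a nonzero Leibniz term, which assigns distinct columns to the rows; a row outside [J]
    is zero in [B] and so gets a column of [A]. *)
Lemma feasible_matched (R : realType) (n : nat)
    (Abar : structural_matrix n n) (J : {set 'I_n}) :
  dedicated_feasible R Abar J -> matched Abar J.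
Proof.
case=> A [B [rA rB ctl]]; pose M := row_mx A B.
have kM : kermx M = 0.
  have := mulmx_ker M; rewrite mul_mx_row -[0]row_mx0 => /eq_row_mx[kA kB].
  by apply: (controllable_invariant_rows0 (N := 0) ctl); rewrite ?mul0mx.
have fullM : row_full M^T.
  by rewrite /row_full mxrank_tr -[_ == _]/(row_free M) -kermx_eq0 kM.
have := fullrowsub_unit fullM.
rewrite unitmxE unitfE => /det_neq0_perm[s sP].
pose g i := fullrankfun fullM ((s^-1)%g i).
have gM i : M i (g i) != 0.
  by have := sP ((s^-1)%g i); rewrite !mxE permKV.
have g_inj : injective g by move=> i i' /fullrankfun_inj/perm_inj.
have gP i : i \notin J -> exists2 j, g i = lshift _ j & A i j != 0.
  move=> iJ; have := gM i; case: (split_ordP (g i)) => k -> ; rewrite ?row_mxEl.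
    by exists k.
  rewrite row_mxEr rB ?eqxx // structural_id_colsE.
  by apply: contraNF iJ => /eqP ->; exact: enum_valP.
(* The default [i] is taken only when [g i] is a column of [B], which forces [i \in J]. *)
exists (fun i => if fintype.split (g i) is inl j then j else i) => [i i'|i iJ].
  rewrite !inE => /gP[j gi _] /gP[j' gi' _]; rewrite gi gi' !(unsplitK (inl _)).
  by move=> jj; apply: g_inj; rewrite gi gi' jj.
have [j -> Aij] := gP i iJ; rewrite (unsplitK (inl _)).
by apply: contraNT Aij => /negbTE/rA ->.
Qed.

(** * Controllable realizations *)

Section Krylov.
Variables (R : nzRingType) (n p : nat) (A : 'M[R]_n) (B : 'M[R]_(n, p)).

Lemma krylov0 : krylov A B 0.
Proof. by rewrite -(mulmx0 _ B); exact: krylov_input. Qed.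

Lemma krylovZ a x : krylov A B x -> krylov A B (a *: x).
Proof. by move=> Kx; rewrite -[_ *: _]addr0; apply: krylov_lin => //; exact: krylov0. Qed.

Lemma krylovD x y : krylov A B x -> krylov A B y -> krylov A B (x + y).
Proof. by move=> Kx Ky; rewrite -[x]scale1r; exact: krylov_lin. Qed.

Lemma krylov_sum (I : finType) (P : pred I) (F : I -> 'cV[R]_n) :
  (forall i, P i -> krylov A B (F i)) -> krylov A B (\sum_(i | P i) F i).
Proof. by move=> KF; elim/big_ind: _ => //; [exact: krylov0 | exact: krylovD]. Qed.

Lemma krylov_all (K : forall i, krylov A B (delta_mx i 0)) x : krylov A B x.
Proof.
rewrite (matrix_sum_delta x); apply: krylov_sum => i _; rewrite big_ord1.
exact: krylovZ.
Qed.
End Krylov.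

Lemma horner_mx_MXaddC (R : comNzRingType) (n m : nat) (A : 'M[R]_n.+1)
    (q : {poly R}) (c : R) (x : 'M[R]_(n.+1, m)) :
  horner_mx A (q * 'X + c%:P) *m x = A *m (horner_mx A q *m x) + c *: x.
Proof.
rewrite rmorphD rmorphM /= horner_mx_X horner_mx_C mulmxDl mul_scalar_mx mulmxA.
by congr (_ *m _ + _); apply/esym/comm_mx_horner.
Qed.

Lemma krylov_horner (R : comNzRingType) (n p : nat) (A : 'M[R]_n.+1)
    (B : 'M[R]_(n.+1, p)) (q : {poly R}) x :
  krylov A B x -> krylov A B (horner_mx A q *m x).
Proof.
move=> Kx; elim/poly_ind: q => [|q c IH]; first by rewrite rmorph0 mul0mx; exact: krylov0.
rewrite horner_mx_MXaddC; apply: krylovD; last exact: krylovZ.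
exact: krylov_mul.
Qed.

(** The polynomials [X^k - m] are pairwise coprime, so [g] shares a factor with finitely many of
    them only. Induction on the size: the gcd with an offending one is divided out and is coprime to
    all the others. *)
Lemma coprimep_Xn_subC_eventually (R : numFieldType) (k : nat) (g : {poly R}) :
  g != 0 -> exists N, forall m : nat, (N < m)%N -> coprimep g ('X^k - m%:R%:P).
Proof.
move: {2}(size g) (leqnn (size g)) => d; elim: d g => [|d IH] g sg g0.
  by move: g0; rewrite -size_poly_leq0 sg.
have [H|] := pselect (forall m : nat, coprimep g ('X^k - m%:R%:P)).
  by exists 0%N => m _; exact: H.
move/existsNP => [m0 /negP ncop].
pose h := gcdp g ('X^k - m0%:R%:P).
have h0 : h != 0 by rewrite gcdp_eq0 negb_and g0.
have hX : h %| 'X^k - m0%:R%:P by exact: dvdp_gcdr.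
have [g' gE] : exists g' : {poly R}, g = g' * h by apply/dvdpP; exact: dvdp_gcdl.
have g'0 : g' != 0 by apply: contraNneq g0 => g'0; rewrite gE g'0 mul0r.
have sh : (1 < size h)%N.
  by rewrite ltn_neqAle lt0n size_poly_eq0 h0 andbT eq_sym.
clearbody h; have [|N HN] := IH g' _ g'0.
  have aux a b : ((a + b).-1 <= d.+1)%N -> (1 < b)%N -> (a <= d)%N by lia.
  by apply: aux sh; rewrite -size_mul // -gE.
exists (maxn N m0) => m; rewrite gtn_max => /andP[Nm m0m].
rewrite gE coprimepMl HN //=.
have : coprimep ('X^k - m0%:R%:P) ('X^k - m%:R%:P : {poly R}).
  apply/Bezout_eq1_coprimepP; exists ((m%:R - m0%:R)^-1%:P, - (m%:R - m0%:R)^-1%:P) => /=.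
  have -> (a x y z : {poly R}) : a * (x - y) + - a * (x - z) = a * (z - y) by ring.
  rewrite -polyCB -polyCM mulVf // -natrB; last exact: ltnW.
  by rewrite pnatr_eq0 subn_eq0 -ltnNge.
exact: coprimep_dvdr.
Qed.

(** * Attaching a cycle to a controllable subsystem *)

Section CycleStep.
Variables (R : numFieldType) (n p : nat) (B : 'M[R]_(n.+1, p)).
Variables (A : 'M[R]_n.+1) (S : {set 'I_n.+1}) (s c : 'I_n.+1).
Local Notation e i := (delta_mx i 0 : 'cV[R]_n.+1).
Hypothesis B_supp : forall i k, i \notin S -> B i k = 0.
Hypothesis A_supp : forall i j, i \notin S -> A i j = 0.
Hypothesis sS : s \in S.
Hypothesis KS : forall i, i \in S -> krylov A B (e i).

(* [A'] extends the subsystem on [S] with an edge of weight 1 from [s] to [c];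
   what it does outside [S] is left open. *)
Definition feeds (A' : 'M[R]_n.+1) :=
  forall v : 'cV[R]_n.+1, (forall i, i \notin S -> v i 0 = 0) ->
    A' *m v = A *m v + v s 0 *: e c.

Lemma krylov_supp v : krylov A B v -> forall i, i \notin S -> v i 0 = 0.
Proof.
elim=> {v} [y|v _ _|a v w _ IHv _ IHw] i iS.
- by rewrite mxE big1 // => k _; rewrite B_supp ?mul0r.
- by rewrite mxE big1 // => k _; rewrite A_supp ?mul0r.
by rewrite !mxE IHv ?IHw ?mulr0 ?addr0.
Qed.

(** On vectors supported in [S], [A'] and [A] differ by multiples of [e c], and these errors
    accumulate into a polynomial in [A'] applied to [e c]. The quantifier order matters: one [q]
    serves every [A'], hence every cycle weight. *)
Lemma krylov_lift v : krylov A B v -> exists q, forall A', feeds A' ->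
  krylov A' B (v + horner_mx A' q *m e c).
Proof.
elim=> {v} [y|v Kv [q Hq]|a v w _ [q Hq] _ [r Hr]].
- by exists 0 => A' _; rewrite rmorph0 mul0mx addr0; exact: krylov_input.
- exists (q * 'X + (v s 0)%:P) => A' FA'.
  rewrite horner_mx_MXaddC addrCA -FA'; last exact: krylov_supp.
  by rewrite -mulmxDr addrC; apply: krylov_mul; apply: Hq.
exists (a%:P * q + r) => A' FA'.
rewrite rmorphD rmorphM /= horner_mx_C -mulmxE mul_scalar_mx mulmxDl -scalemxAl.
rewrite addrACA -scalerDr; apply: krylov_lin; [exact: Hq | exact: Hr].
Qed.

(** Apply the characteristic polynomial of [A] to [e s] and lift: by Cayley-Hamilton only a
    polynomial in [A'] applied to [e c] remains. *)
Lemma krylov_relation : exists2 g : {poly R}, g != 0 &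
  forall A', feeds A' -> krylov A' B (horner_mx A' g *m e c).
Proof.
have [q Hq] := krylov_lift (KS sS).
(* The size of [r] is tracked exactly to show that the final relation is nonzero: if [q] is zero
   then [r] alone remains, otherwise [r] is shorter than [char_poly A * q]. *)
have rel (m : {poly R}) : exists2 r : {poly R}, size r = (size m).-1 &
    forall A', feeds A' ->
      krylov A' B (horner_mx A m *m e s + horner_mx A' (m * q + r) *m e c).
  elim/poly_ind: m => [|m a [r rs Hr]].
    exists 0; first by rewrite size_poly0.
    by move=> A' _; rewrite mul0r addr0 !rmorph0 !mul0mx addr0; exact: krylov0.
  pose v := horner_mx A m *m e s.
  have Kv : krylov A B v by apply: krylov_horner; exact: KS.
  exists (r * 'X + (v s 0)%:P).
    have [m0|m0] := eqVneq m 0.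
      move: rs; rewrite /v m0 size_poly0 => /eqP; rewrite size_poly_eq0 => /eqP ->.
      rewrite !mul0r !add0r rmorph0 mul0mx mxE !size_polyC eqxx.
      by case: (_ != 0).
    rewrite (size_MXaddC m) (negbTE m0) /=.
    have [r0|r0] := eqVneq r 0.
      have /size_poly1P[b b0 mb] : size m == 1%N.
        by move: rs m0; rewrite r0 size_poly0 -size_poly_gt0; case: (size m) => [|[|]].
      rewrite r0 mul0r add0r /v mb horner_mx_C mul_scalar_mx !mxE !eqxx mulr1.
      by rewrite !size_polyC b0.
    rewrite size_MXaddC (negbTE r0) /= rs prednK // lt0n size_poly_eq0 //.
  move=> A' FA'.
  rewrite horner_mx_MXaddC.
  have -> : (m * 'X + a%:P) * q + (r * 'X + (v s 0)%:P) =
            (m * q + r) * 'X + (v s 0)%:P + a%:P * q by ring.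
  rewrite rmorphD /= mulmxDl horner_mx_MXaddC rmorphM /= horner_mx_C -mulmxE mul_scalar_mx.
  rewrite -scalemxAl addrACA -scalerDr; apply: krylovD.
    rewrite addrCA -/v -FA'; last exact: krylov_supp.
    by rewrite -mulmxDr addrC; apply: krylov_mul; apply: Hr.
  by apply: krylovZ; apply: Hq.
have [r rs Hr] := rel (char_poly A).
exists (char_poly A * q + r).
  move: rs; rewrite size_char_poly /= => rs; have [->|q0] := eqVneq q 0.
    by rewrite mulr0 add0r -size_poly_gt0 rs.
  rewrite -size_poly_gt0 size_polyDl.
    by rewrite size_poly_gt0 mulf_neq0 // monic_neq0 // char_poly_monic.
  rewrite rs size_monicM ?char_poly_monic // size_char_poly.
  by move: q0; rewrite -size_poly_gt0; case: (size q) => // ? _; rewrite addnS ltnS leq_addr.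
by move=> A' FA'; have := Hr A' FA'; rewrite Cayley_Hamilton mul0mx add0r.
Qed.
End CycleStep.

Lemma connect_boundary (T : finType) (e : rel T) (S : {set T}) x y :
  connect e x y -> x \notin S -> y \in S ->
  exists c s, [/\ e c s, c \notin S & s \in S].
Proof.
case/connectP => q; elim: q x => [|z q IH] x /=.
  by move=> _ -> /negP.
case/andP => xz zq yE xS yS; have [zS|zS] := boolP (z \in S).
  by exists x, z.
exact: IH zq yE zS yS.
Qed.

(** * Assembling paths and cycles into a realization *)

Section Cactus.
Variables (R : realType) (n : nat).
Variables (Abar : structural_matrix n.+1 n.+1) (J : {set 'I_n.+1}).
Variable f : 'I_n.+1 -> 'I_n.+1.
Hypothesis f_inj : {in ~: J &, injective f}.
Hypothesis f_edge : forall i, i \notin J -> Abar i (f i).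
Local Notation e i := (delta_mx i 0 : 'cV[R]_n.+1).

Definition dedicated_mx : 'M[R]_(n.+1, #|J|) :=
  \matrix_(i, k) (i == enum_val k)%:R.
Local Notation B := dedicated_mx.

Lemma mulmx_delta (A : 'M[R]_n.+1) i j : (A *m e j) i 0 = A i j.
Proof. by rewrite -colE mxE. Qed.

Lemma krylov_dedicated A j : j \in J -> krylov A B (e j).
Proof.
move=> jJ; have -> : e j = B *m delta_mx (enum_rank_in jJ j) 0.
  by apply/matrixP => i k; rewrite (ord1 k) -colE !mxE enum_rankK_in // andbT.
exact: krylov_input.
Qed.

(** Invariant of the construction: a partial realization confined to [S] that already generates all
    of [S], its other entries being left to fill. *)
Definition settled (S : {set 'I_n.+1}) (A : 'M[R]_n.+1) :=
  [/\ realization Abar A,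
      forall i j, A i j != 0 -> (i \in S) && (j \in S) &
      forall i, i \in S -> krylov A B (e i)].

(** [S] collects the vertices whose [f]-orbit meets [J]: the paths of the matching. With weight 1 on
    the edges from [f i] to [i], injectivity of [f] gives [A *m e (f i) = e i], so the paths are
    generated starting from [J]. *)
Lemma settled_paths : exists (S : {set 'I_n.+1}) (A : 'M[R]_n.+1),
  [/\ settled S A, J \subset S & forall i, i \notin S -> f i \notin S].
Proof.
pose S := [set v | `[< exists m, iter m f v \in J >]].
have SP v : reflect (exists m, iter m f v \in J) (v \in S).
  by rewrite inE; exact: asboolP.
have JS : J \subset S by apply/fintype.subsetP => j jJ; apply/SP; exists 0%N.
pose A : 'M[R]_n.+1 := \matrix_(i, j) ((i \in S) && (i \notin J) && (j == f i))%:R.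
exists S, A; split => //; last first.
  by move=> i; apply: contraNN => /SP[m fm]; apply/SP; exists m.+1; rewrite iterSr.
split=> [i j Aij|i j|].
- rewrite mxE; case: eqP => [jf|_]; last by rewrite andbF.
  by case: (boolP (i \in J)) => [|/f_edge]; rewrite ?andbF // -jf Aij.
- rewrite mxE; have [/andP[/andP[iS iJ] /eqP ->] _|_] := boolP (_ && _); last by rewrite eqxx.
  rewrite iS /=; case/SP: iS => -[|m]; first by rewrite /= (negbTE iJ).
  by rewrite iterSr => fm; apply/SP; exists m.
move=> i /SP[m]; elim: m i => [|m IH] i /= im; first exact: krylov_dedicated.
have [/krylov_dedicated //|iJ] := boolP (i \in J).
have iS : i \in S by apply/SP; exists m.+1.
suff <- : A *m e (f i) = e i by apply: krylov_mul; apply: IH; rewrite -iterSr.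
apply/matrixP => k l; rewrite (ord1 l) mulmx_delta !mxE eqxx andbT; congr ((nat_of_bool _)%:R).
have [->|ki] := eqVneq k i; first by rewrite iS iJ eqxx.
have [|kJ] := boolP (k \in J); rewrite ?andbF // andbT.
apply/negbTE/negP => /andP[_ /eqP fik]; case/eqP: ki; apply: f_inj; rewrite ?inE //.
Qed.

(** Outside [S] the matching consists of cycles. The edges of the one through [c] receive weight
    [a], and the single edge from [s] to [c] has weight 1. *)
Lemma settled_cycle (S : {set 'I_n.+1}) (A : 'M[R]_n.+1) (s c : 'I_n.+1) :
  settled S A -> J \subset S -> (forall i, i \notin S -> f i \notin S) ->
  s \in S -> c \notin S -> Abar c s ->
  exists (S' : {set 'I_n.+1}) (A' : 'M[R]_n.+1),
  [/\ settled S' A', S \subset S', c \in S' & forall i, i \notin S' -> f i \notin S'].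
Proof.
move=> [rA suppA KA] /fintype.subsetP JS fS sS cS Acs.
(* Fixing [S] pointwise makes [g] a permutation of all vertices, so the orbit of [c] is a genuine
   cycle. *)
pose g i := if i \in S then i else f i.
have gS i : (g i \in S) = (i \in S).
  by rewrite /g; have [|/fS/negbTE] := boolP (i \in S).
have g_inj : injective g.
  move=> i i' gii; have iS : (i \in S) = (i' \in S) by rewrite -gS gii gS.
  move: gii; rewrite /g -iS; case: ifP => // /negbT iN.
  have J' k : k \notin S -> k \in ~: J by rewrite inE; apply: contraNN => /JS.
  by apply: f_inj; apply: J'; rewrite -?iS.
pose C := [set i | fconnect g c i].
have CS i : i \in C -> i \notin S.
  rewrite inE => /iter_findex <-; move: (findex _ _ _) => m.
  by elim: m => //= m; rewrite gS.
have gC i : (g i \in C) = (i \in C).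
  by rewrite !inE -(same_fconnect1_r g_inj).
have A0l i j : i \notin S -> A i j = 0.
  by move=> iS; apply/eqP; apply: contraNT iS => /suppA/andP[].
have A0r i j : j \notin S -> A i j = 0.
  by move=> jS; apply/eqP; apply: contraNT jS => /suppA/andP[].
have B_supp i k : i \notin S -> B i k = 0.
  rewrite mxE; case: eqP => // -> /negP[]; apply: JS; exact: enum_valP.
have [q q0 qP] := krylov_relation c B_supp A0l sS KA.
pose k := fingraph.order g c.
have [N NP] := coprimep_Xn_subC_eventually k q0.
(* [N.+1] exceeds [N], and so does its [k]-th power, because the orbit length [k] is positive. *)
pose a : R := N.+1%:R.
have a0 : a != 0 by rewrite pnatr_eq0.
pose A' : 'M[R]_n.+1 := \matrix_(i, j) (A i j
  + (if (i \in C) && (j == g i) then a else 0) + ((i == c) && (j == s))%:R).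
have feedsA' : feeds A S s c A'.
  move=> v v0; apply/matrixP => i l; rewrite (ord1 l) !mxE.
  transitivity (\sum_j (A i j * v j 0 + ((i == c) && (j == s))%:R * v j 0)).
    apply: eq_bigr => j _; rewrite mxE !mulrDl; congr (_ + _).
    case: ifP => [/andP[iC /eqP ->]|_]; last by rewrite mul0r addr0.
    by rewrite v0 ?mulr0 ?addr0 // gS CS.
  rewrite big_split /=; congr (_ + _); rewrite (bigD1 s) //= big1 ?addr0.
    by rewrite eqxx !andbT mulrC.
  by move=> j js; rewrite (negbTE js) andbF mul0r.
have A'_back i : i \in C -> A' *m e (g i) = a *: e i.
  move=> iC; apply/matrixP => j l; rewrite (ord1 l) mulmx_delta !mxE eqxx andbT.
  have giS : g i \notin S by rewrite gS CS.
  rewrite A0r // add0r (_ : g i == s = false) ?andbF ?addr0; last first.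
    by apply: contraNF giS => /eqP ->.
  rewrite (inj_eq g_inj) eq_sym; have [->|_] := eqVneq j i; rewrite ?iC ?mulr1 //.
  by rewrite andbF mulr0.
have iterC m : iter m g c \in C by rewrite inE fconnect_iter.
have A'_iter m : A' ^+ m *m e (iter m g c) = a ^+ m *: e c.
  elim: m => [|m IH]; first by rewrite !expr0 mul1mx scale1r.
  rewrite !exprSr -mulmxE -mulmxA /= A'_back // -scalemxAr IH scalerA.
  by rewrite mulrC.
have A'_cycle : horner_mx A' ('X^k - (a ^+ k)%:P) *m e c = 0.
  rewrite rmorphB rmorphXn /= horner_mx_X horner_mx_C mulmxBl mul_scalar_mx.
  by rewrite -A'_iter iter_order // subrr.
have Kc : krylov A' B (e c).
  have : coprimep q ('X^k - (a ^+ k)%:P).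
    rewrite /a -natrX; apply: NP.
    apply: (@leq_trans (N.+1 ^ 1)); first by rewrite expn1.
    by apply: leq_pexp2l => //; exact: fingraph.order_gt0.
  case/Bezout_eq1_coprimepP => -[u w] /= uw.
  rewrite -[e c]mul1mx idmxE -(rmorph1 (horner_mx A')) -uw rmorphD !rmorphM /=.
  rewrite mulmxDl -mulmxE -!mulmxA A'_cycle mulmx0 addr0.
  by apply: krylov_horner; apply: qP.
(* Going backwards around the cycle: [A'] sends [e (g i)] to [a *: e i], and the walk starts at
   [iter k g c], which is [c]. *)
have KC m : (m <= k)%N -> krylov A' B (e (iter (k - m) g c)).
  elim: m => [|m IH] mk; first by rewrite subn0 iter_order.
  set i := iter _ g c; have iC : i \in C by exact: iterC.
  have -> : e i = a^-1 *: (A' *m e (g i)) by rewrite A'_back // scalerA mulVf ?scale1r.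
  by apply/krylovZ/krylov_mul; rewrite /i -iterS -subSn // subSS; apply/IH/ltnW.
exists (S :|: C), A'; split.
- split.
  + move=> i j Aij; rewrite mxE rA // add0r (_ : _ && (j == s) = false) ?addr0.
      case: ifP => // /andP[iC /eqP ji]; move: Aij; rewrite ji /g (negbTE (CS _ iC)).
      rewrite f_edge //; apply/negP => /JS; exact/negP/CS.
    by apply: contraFF Aij => /andP[/eqP -> /eqP ->].
  + move=> i j; apply: contraNT; rewrite mxE !inE => ij.
    rewrite (_ : A i j = 0) ?add0r; last first.
      apply/eqP; apply: contraNT ij => /suppA/andP[-> ->]; by [].
    rewrite (_ : _ && (j == s) = false) ?addr0; last first.
      by apply: contraNF ij => /andP[/eqP -> /eqP ->]; rewrite sS connect0 orbT.
    case: ifP => // /andP[iC /eqP ji]; case/negP: ij.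
    by rewrite ji; move: (gC i) iC; rewrite !inE => -> ->; rewrite !orbT.
  move=> i; rewrite inE => /orP[iS|]; last first.
    rewrite inE => ci; rewrite -(iter_findex ci) -[findex _ _ _](@subKn _ k).
      exact/KC/leq_subr.
    exact/ltnW/findex_max.
  (* The lift of [e i] differs from it by a polynomial in [A'] applied to [e c], which now lies in
     the Krylov space. *)
  have [r rP] := krylov_lift s c B_supp A0l (KA i iS).
  have := rP _ feedsA'.
  move/(krylovD (krylovZ (-1) (krylov_horner r Kc))).
  by rewrite scaleN1r addrCA addNr addr0.
- exact: finset.subsetUl.
- by rewrite !inE connect0 orbT.
move=> i; rewrite !inE !negb_or => /andP[iS iC].
rewrite fS //=; apply: contraNN iC => iC.
have gi : g i = f i by rewrite /g (negbTE iS).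
by have := gC i; rewrite !inE gi => <-.
Qed.
End Cactus.

(** As long as the complement of [S] is nonempty, accessibility provides an edge entering it from
    [S]; attaching the cycle of its endpoint [c] strictly enlarges [S]. *)
Lemma accessible_matched_feasible_pos (R : realType) (n : nat)
    (Abar : structural_matrix n.+1 n.+1) (J : {set 'I_n.+1}) :
  accessible Abar J -> matched Abar J -> dedicated_feasible R Abar J.
Proof.
move=> acc [f f_inj f_edge].
suff [A [rA _ KA]] : exists A, @settled R _ Abar J [set: 'I_n.+1] A.
  exists A, (@dedicated_mx R _ J); split=> //.
    by move=> i k; rewrite structural_id_colsE mxE => ->.
  by apply/krylov_controllable/krylov_all => i; apply: KA; rewrite inE.
have [S0 [A0 [set0 JS0 fS0]]] := settled_paths R f_inj f_edge.
suff loop m : forall S A, (#|~: S| <= m)%N -> @settled R _ Abar J S A -> J \subset S ->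
    (forall i, i \notin S -> f i \notin S) -> exists A, @settled R _ Abar J [set: 'I_n.+1] A.
  exact: (loop _ S0 A0 (leqnn _)).
elim: m => [|m IH] S A Sm setS JS fS; have [ST|] := boolP ([set: 'I_n.+1] \subset S).
- by exists A; rewrite (_ : [set: _] = S) //; apply/eqP; rewrite finset.eqEsubset ST finset.subsetT.
- case/subsetPn => v _ vS; move: Sm; rewrite leqNgt => /negP[].
  by apply/card_gt0P; exists v; rewrite inE.
- by exists A; rewrite (_ : [set: _] = S) //; apply/eqP; rewrite finset.eqEsubset ST finset.subsetT.
case/subsetPn => v _ vS.
have [j jJ vj] := acc v.
have [c [s [Acs cS sS]]] := connect_boundary vj vS (fintype.subsetP JS _ jJ).
have [S' [A' [set' SS' cS' fS']]] := settled_cycle f_inj f_edge setS JS fS sS cS Acs.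
apply: (IH S' A') => //; last exact: fintype.subset_trans SS'.
rewrite -ltnS; apply: leq_trans Sm; apply: proper_card.
apply/properP; split; first by rewrite finset.setCS.
by exists c; rewrite !inE ?cS' // cS.
Qed.

Theorem feasible_iff (R : realType) (n : nat)
    (Abar : structural_matrix n n) (J : {set 'I_n}) :
  dedicated_feasible R Abar J <-> accessible Abar J /\ matched Abar J.
Proof.
split=> [FJ|[]].
  by split; [exact: feasible_accessible FJ | exact: feasible_matched FJ].
(* Polynomials of a matrix are taken in positive dimension; for [n = 0] the only state is 0. *)
case: n Abar J => [|n] Abar J; last exact: accessible_matched_feasible_pos.
move=> _ _; exists 0, 0; split=> [i|i|]; rewrite ?mxE //; try by case: i.
by apply: krylov_controllable => x; rewrite [x]flatmx0; exact: krylov0.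
Qed.

(** * Optimal inputs from a maximum matching *)

Local Close Scope ring_scope.
Local Open Scope nat_scope.

Section Optimum.
Variables (n : nat) (Abar : structural_matrix n n).

Definition reach : rel 'I_n := connect (fun i j => Abar i j).

(* The least vertex of a strongly connected component that no other component
   influences. *)
Definition source_rep (v : 'I_n) := [forall u, reach v u ==> reach u v && (v <= u)].

Lemma reach_trans u v w : reach u v -> reach v w -> reach u w.
Proof. exact: connect_trans. Qed.

(** Among the vertices reachable from [v], one with the fewest reachable vertices lies in a
    component that no other influences; the least member of that component is the representative. *)
Lemma source_rep_exists v : exists2 r, source_rep r & reach v r.
Proof.
have rv : reach v v by exact: connect0.
case: (arg_minnP (fun u => #|[set w | reach u w]|) rv) => u vu u_min.
have ru : reach u u by exact: connect0.
have sym w : reach u w -> reach w u.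
  move=> uw; apply: contraT => wu.
  have := u_min w (reach_trans vu uw); rewrite leqNgt => /negP[].
  apply: proper_card; apply/properP; split.
    by apply/fintype.subsetP => x; rewrite !inE; exact: reach_trans.
  by exists u; rewrite !inE ?ru.
case: (arg_minnP (fun w : 'I_n => val w) ru) => r ur r_min.
exists r; last exact: reach_trans ur.
apply/forallP => w; apply/implyP => rw; have uw := reach_trans ur rw.
by rewrite (reach_trans (sym _ uw) ur) r_min.
Qed.

(** Through [j] the two representatives reach each other, and each is least in its component. Hence
    one input can drive at most one source component. *)
Lemma source_rep_inj r r' j : source_rep r -> source_rep r' ->
  reach r j -> reach r' j -> r = r'.
Proof.
move=> /forallP Hr /forallP Hr' rj r'j.
have := Hr j; have := Hr' j; rewrite rj r'j => /andP[jr' _] /andP[jr _].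
have := Hr r'; rewrite (reach_trans rj jr') => /andP[_ le].
have := Hr' r; rewrite (reach_trans r'j jr) => /andP[_ le'].
by apply/val_inj/eqP; rewrite eqn_leq le.
Qed.

(* Column [j < n] is the state column [j]; column [n + v] is a slot reserved for
   the input that must drive the component represented by [v]. *)
Definition slot_edge (j : 'I_(n + n)) (i : 'I_n) : bool :=
  match fintype.split j with
  | inl k => Abar i k
  | inr v => source_rep v && reach v i
  end.

Variable mate : 'I_(n + n) -> option 'I_n.
Hypothesis mate_edge : forall j i, mate j = Some i -> slot_edge j i.
Hypothesis mate_inj : forall j j' i, mate j = Some i -> mate j' = Some i -> j = j'.
Hypothesis mate_max : forall (X : {set 'I_n}) (h : 'I_n -> 'I_(n + n)),
  {in X &, injective h} -> (forall i, i \in X -> slot_edge (h i) i) ->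
  #|X| <= #|[set j | mate j]|.

(** A row matched to a slot has no state column, so the single input placed there both covers the
    row and drives the component of the slot. A component whose slot stays unmatched gets its
    representative as an input. *)
Definition chosen_inputs : {set 'I_n} :=
  [set i | ~~ [exists j : 'I_n, mate (lshift n j) == Some i]
           || source_rep i && ~~ mate (rshift n i)].

Lemma chosen_accessible : accessible Abar chosen_inputs.
Proof.
move=> v; have [r rr vr] := source_rep_exists v.
case mr : (mate (rshift n r)) => [i|]; last first.
  by exists r => //; rewrite inE rr mr orbT.
exists i.
  rewrite inE negb_exists; apply/orP; left; apply/forallP => j; apply/eqP => mj.
  have /eqP := mate_inj mj mr.
  by rewrite -val_eqE /= => /eqP; have := ltn_ord j; lia.
have := mate_edge mr; rewrite /slot_edge (unsplitK (inr _)) => /andP[_].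
exact: reach_trans.
Qed.

Lemma chosen_matched : matched Abar chosen_inputs.
Proof.
pose f i := odflt i [pick j | mate (lshift n j) == Some i].
have fP i : i \notin chosen_inputs -> mate (lshift n (f i)) = Some i.
  rewrite inE negb_or negbK => /andP[/existsP[j /eqP mj] _].
  by rewrite /f; case: pickP => [k /eqP //|/(_ j)]; rewrite mj eqxx.
exists f => [i i'|i /fP/mate_edge]; last by rewrite /slot_edge (unsplitK (inl _)).
by rewrite !finset.in_setC => /fP mi /fP mi' fE; move: mi; rewrite fE mi' => -[].
Qed.

(** [J] yields a matching: [f] on the rows outside [J], and the slot of each representative [r] on
    an input [dr r] that drives it. Its size, [n - #|J|] plus the number [b] of representatives, is
    at most the size of [mate], whereas [chosen_inputs] has at most [n + b] minus the size of [mate]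
    elements. *)
Lemma chosen_card_le (J : {set 'I_n}) :
  accessible Abar J -> matched Abar J -> #|chosen_inputs| <= #|J|.
Proof.
move=> accJ [f f_inj f_edge].
pose dr r := odflt r [pick j in J | reach r j].
have drP r : dr r \in J /\ reach r (dr r).
  rewrite /dr; case: pickP => [j /andP[] //|H]; have [j jJ rj] := accJ r.
  by have := H j; rewrite jJ /= -[reach r j]/(connect _ r j) rj.
have dr_inj : {in [set r | source_rep r] &, injective dr}.
  move=> r r'; rewrite !inE => Hr Hr' E; apply: (source_rep_inj Hr Hr' (drP r).2).
  by rewrite E; exact: (drP r').2.
pose D := dr @: [set r | source_rep r].
have DJ : D \subset J.
  by apply/fintype.subsetP => x /imsetP[r _ ->]; exact: (drP r).1.
pose h x := if x \in J then odflt (rshift n x)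
              (omap (@rshift n n) [pick r | source_rep r && (dr r == x)])
            else lshift n (f x).
have hD r : source_rep r -> h (dr r) = rshift n r.
  move=> Hr; rewrite /h (drP r).1; case: pickP => [r' /andP[Hr' /eqP E]|/(_ r)].
    by rewrite /= (dr_inj r' r) ?inE.
  by rewrite Hr eqxx.
have hJ x : x \notin J -> h x = lshift n (f x) by rewrite /h => /negbTE ->.
have disj : ~: J :&: D = finset.set0.
  apply/finset.setP => x; rewrite !inE; apply/negP => /andP[xJ /(fintype.subsetP DJ)].
  by rewrite (negbTE xJ).
have cardC (K : {set 'I_n}) : #|~: K| = n - #|K|.
  by have := cardsC K; rewrite card_ord; lia.
have cardX : #|~: J :|: D| = n - #|J| + #|[set r | source_rep r]|.
  by rewrite cardsU disj cards0 subn0 card_in_imset // cardC.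
have : #|~: J :|: D| <= #|[set j | mate j]|.
  apply: (@mate_max _ h) => [x x'|x]; rewrite !finset.in_setU !finset.in_setC.
    move=> /orP[xJ|/imsetP[r Hr ->]] /orP[x'J|/imsetP[r' Hr' ->]].
    - by rewrite !hJ // => /lshift_inj; apply: f_inj; rewrite finset.in_setC.
    - by move: Hr'; rewrite inE => Hr'; rewrite (hJ x) // hD // => /eqP; rewrite eq_lrshift.
    - by move: Hr; rewrite inE => Hr; rewrite (hJ x') // hD // => /eqP; rewrite eq_rlshift.
    - by move: Hr Hr'; rewrite !inE => Hr Hr'; rewrite !hD // => /rshift_inj ->.
  case/orP => [xJ|/imsetP[r]].
    by rewrite hJ // /slot_edge (unsplitK (inl _)); exact: f_edge.
  rewrite inE => Hr ->; rewrite hD // /slot_edge (unsplitK (inr _)) Hr.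
  exact: (drP r).2.
pose MS := [set j | mate (lshift n j)]; pose MR := [set v | mate (rshift n v)].
have -> : #|[set j | mate j]| = #|MS| + #|MR|.
  by rewrite -!sum1dep_card big_mkcond big_split_ord /= -!big_mkcond.
pose P := [set i | [exists j, mate (lshift n j) == Some i]].
have MSP : #|MS| <= #|P|.
  rewrite -(card_in_imset (f := fun j => odflt j (mate (lshift n j)))); last first.
    move=> j j'; rewrite !inE; case mj: (mate _) => [i|] //= _.
    case mj': (mate _) => [i'|] //= _ ii; rewrite -ii in mj'.
    exact/lshift_inj/(mate_inj mj mj').
  apply/subset_leq_card/fintype.subsetP => i /imsetP[j]; rewrite !inE.
  by case mj: (mate _) => [i'|] //= _ ->; apply/existsP; exists j; rewrite mj.
have MRr : MR \subset [set r | source_rep r].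
  apply/fintype.subsetP => v; rewrite !inE; case mv: (mate _) => [i|] // _.
  by have := mate_edge mv; rewrite /slot_edge (unsplitK (inr _)) => /andP[].
have -> : chosen_inputs = ~: P :|: ([set r | source_rep r] :\: MR).
  by apply/finset.setP => i; rewrite !inE andbC.
rewrite cardX => le; apply: leq_trans (leq_card_setU _ _) _.
rewrite cardC cardsD (finset.setIidPr MRr).
have cardn (K : {set 'I_n}) : #|K| <= n by rewrite -[X in _ <= X]card_ord max_card.
have aux a b c d e : n - a + b <= c + d -> c <= e -> d <= b -> a <= n -> e <= n ->
  n - e + (b - d) <= a by lia.
exact: aux le MSP (subset_leq_card MRr) (cardn J) (cardn P).
Qed.

Lemma chosen_optimal (R : realType) : min_dedicated_input R Abar chosen_inputs.
Proof.
split; first by apply/feasible_iff; split; [exact: chosen_accessible | exact: chosen_matched].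
by move=> J /feasible_iff[]; exact: chosen_card_le.
Qed.

End Optimum.

(** * Matching by auction *)

Section Auction.
Variables (m n : nat) (E : nat -> nat -> bool).

(* Columns carry prices [d]; [mu j] is [i.+1] when column [j] is sold to row [i]
   and [0] when it is unsold; [cur] is likewise the bidding row, if any, and the
   rows from [r] on have not entered yet.  A row gives up once all prices exceed
   [n]. *)
Record auction (d mu : nat -> nat) (cur r : nat) : Prop := Auction {
  auction_entered : r <= n;
  auction_cur : cur <= r;
  auction_row : forall j, j < m -> mu j <= r;
  auction_edge : forall j, j < m -> 0 < mu j -> E j (mu j).-1;
  auction_inj : forall j j', j < m -> j' < m -> 0 < mu j -> mu j = mu j' -> j = j';
  auction_bidder : forall j, j < m -> 0 < mu j -> mu j <> cur;
  auction_unsold : forall j, j < m -> mu j = 0 -> d j = 0;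
  auction_price : forall j, j < m -> d j <= n.+1;
  auction_slack : forall j j', j < m -> j' < m -> 0 < mu j ->
    E j' (mu j).-1 -> d j <= (d j').+1;
  auction_out : forall i, i < r -> i.+1 <> cur ->
    (forall j, j < m -> mu j <> i.+1) -> forall j, j < m -> E j i -> n < d j
}.

Lemma auction_init : auction (fun=> 0) (fun=> 0) 0 0.
Proof. by split. Qed.

Lemma auction_eq d mu d' mu' cur r :
  (forall j, j < m -> d' j = d j) -> (forall j, j < m -> mu' j = mu j) ->
  auction d mu cur r -> auction d' mu' cur r.
Proof.
move=> dE muE [h1 h2 h3 h4 h5 h6 h7 h8 h9 h10]; split=> // j.
- by move=> jm; rewrite muE //; exact: h3.
- by move=> jm; rewrite muE //; exact: h4.
- by move=> j' jm j'm; rewrite !muE //; exact: h5.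
- by move=> jm; rewrite muE //; exact: h6.
- by move=> jm; rewrite muE // dE //; exact: h7.
- by move=> jm; rewrite dE //; exact: h8.
- by move=> j' jm j'm; rewrite muE // !dE //; exact: h9.
move=> jr jc H k km; rewrite dE //; apply: h10 jr jc _ k km => l lm.
by rewrite -muE //; exact: H.
Qed.

Lemma auction_enter d mu r : r < n -> auction d mu 0 r -> auction d mu r.+1 r.+1.
Proof.
move=> rn [h1 h2 h3 h4 h5 h6 h7 h8 h9 h10]; split=> //.
- by move=> j /h3; lia.
- by move=> j /h3; lia.
by move=> i ir ic; apply: h10 => //; lia.
Qed.

Lemma auction_giveup d mu cur r : 0 < cur -> auction d mu cur r ->
  (forall j, j < m -> E j cur.-1 -> n < d j) -> auction d mu 0 r.
Proof.
move=> c0 [h1 h2 h3 h4 h5 h6 h7 h8 h9 h10] H; split=> //.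
- by move=> j _; lia.
move=> i ir _ out; have [ic|] := eqVneq i.+1 cur; last by move/eqP => ic; exact: h10.
by move=> j jm Eji; apply: H => //; rewrite -ic.
Qed.

(** Slack survives because the bidder pays one more than the cheapest price it sees, and for the
    other owners prices never fall. *)
Lemma auction_bid d mu cur r b : 0 < cur -> auction d mu cur r ->
  b < m -> E b cur.-1 -> d b <= n ->
  (forall j, j < m -> E j cur.-1 -> d b <= d j) ->
  auction (upd d b (d b).+1) (upd mu b cur) (mu b) r.
Proof.
move=> c0 [h1 h2 h3 h4 h5 h6 h7 h8 h9 h10] bm Eb dbn H; rewrite /upd; split=> //.
- exact: h3.
- by move=> j jm; case: eqP => // _; exact: h3.
- by move=> j jm; case: eqP => [->|_]; [|exact: h4].
- move=> j j' jm j'm; case: (j =P b) => [->|jb]; case: (j' =P b) => [->|j'b] //.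
  + by move=> _ cE; case: (h6 _ j'm) => //; rewrite -cE.
  + by move=> j0 cE; case: (h6 _ jm).
  by move=> j0; exact: h5.
- move=> j jm; case: eqP => [_ _ cE|jb j0 jE].
    by case: (h6 _ bm) => //; rewrite -cE.
  by case: jb; exact: h5.
- by move=> j jm; case: eqP => [_|_]; [lia|exact: h7].
- by move=> j jm; case: eqP => [_|_]; [lia|exact: h8].
- move=> j j' jm j'm; case: (j =P b) => [_|jb]; case: (j' =P b) => [->|j'b] //.
  + by move=> _ Ej'; rewrite ltnS; exact: H.
  + by move=> j0 Eb'; have := h9 _ _ jm bm j0 Eb'; lia.
  exact: h9.
move=> i ir ib out j jm Eji.
have := out b bm; rewrite eqxx => ci.
have dj : n < d j.
  apply: (h10 i) => //; first by move=> ic; apply: ci.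
  by move=> k km; have := out k km; case: eqP => // -> _ mb; apply: ib.
by case: eqP => // jb; move: dj; rewrite jb; lia.
Qed.

(** Pigeonhole: a column with positive price is sold, owners are distinct, and [n] rows cannot
    occupy all [n.+1] levels. *)
Lemma auction_gap d mu : auction d mu 0 n ->
  exists2 l, 0 < l <= n.+1 & forall j, j < m -> d j <> l.
Proof.
move=> [h1 h2 h3 h4 h5 h6 h7 h8 h9 h10].
have [/forallP H|] := boolP [forall l : 'I_n.+1, [exists j : 'I_m, d j == l.+1]]; last first.
  rewrite negb_forall => /existsP[l]; rewrite negb_exists => /forallP H.
  exists l.+1; first exact: ltn_ord.
  by move=> j jm; apply/eqP; exact: (H (Ordinal jm)).
pose g l := xchoose (existsP (H l)).
have gP l : d (g l) = l.+1 by apply/eqP; exact: xchooseP (existsP (H l)).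
have mg l : 0 < mu (g l).
  by rewrite lt0n; apply/eqP => /(h7 _ (ltn_ord _)); rewrite gP.
have mgn l : (mu (g l)).-1 < n by have := h3 _ (ltn_ord (g l)); have := mg l; lia.
have : injective (fun l => Ordinal (mgn l)).
  move=> l l' [E1]; apply/val_inj => /=.
  have : g l = g l' :> nat.
    by apply: h5 => //; have := mg l; have := mg l'; lia.
  by move=> gg; have := gP l; rewrite gg gP => -[].
by move/leq_card; rewrite !card_ord ltnn.
Qed.

(* At an unused price level [l], the columns priced above [l] and the rows that
   only see such columns form a Koenig certificate of maximality. *)
Lemma auction_max d mu (X : {set 'I_n}) (h : 'I_n -> 'I_m) : auction d mu 0 n ->
  {in X &, injective h} -> (forall i, i \in X -> E (h i) i) ->
  #|X| <= #|[set j : 'I_m | 0 < mu j]|.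
Proof.
move=> A h_inj hE; have [l /andP[l0 ln] gap] := auction_gap A.
case: A => [h1 h2 h3 h4 h5 h6 h7 h8 h9 h10].
pose hi (i : 'I_n) := [forall j : 'I_m, E j i ==> (l < d j)].
have sold i : ~~ hi i -> [exists j : 'I_m, (mu j == i.+1) && (d j <= l)].
  move=> lo; rewrite /hi negb_forall in lo.
  case/existsP: lo => k; rewrite negb_imply -leqNgt => /andP[Ek dk].
  have [/existsP[j /eqP mj]|] := boolP [exists j : 'I_m, mu j == i.+1].
    apply/existsP; exists j; rewrite mj eqxx /=.
    have := h9 j k (ltn_ord _) (ltn_ord _); rewrite mj => /(_ isT Ek).
    by have := gap _ (ltn_ord j); have := gap _ (ltn_ord k); lia.
  rewrite negb_exists => /forallP H.
  have out j : j < m -> mu j <> i.+1 by move=> jm; exact/eqP/(H (Ordinal jm)).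
  have := h10 i (ltn_ord i) (fun e => O_S _ (esym e)) out k (ltn_ord _) Ek.
  by have := gap _ (ltn_ord k); lia.
(* High rows keep their column under [h], low rows take the one they own; the level [l] separates
   the two kinds of image. *)
pose phi i := if hi i then h i else odflt (h i) [pick j : 'I_m | (mu j == i.+1) && (d j <= l)].
have phiP i : ~~ hi i -> mu (phi i) = i.+1 /\ d (phi i) <= l.
  move=> lo; rewrite /phi (negbTE lo); case: pickP => [j /andP[/eqP] //|H].
  by case/existsP: (sold i lo) => j; rewrite H.
have phi_hi i : hi i -> phi i = h i by rewrite /phi => ->.
have phi_d i : i \in X -> hi i -> l < d (phi i).
  by move=> iX hi_i; rewrite phi_hi //; move/forallP/(_ (h i)): hi_i; rewrite hE.
rewrite -(card_in_imset (f := phi)); last first.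
  move=> i i' iX i'X; have [hi_i|lo] := boolP (hi i); have [hi_i'|lo'] := boolP (hi i').
  - by rewrite !phi_hi //; exact: h_inj.
  - by move=> pp; have := phi_d i iX hi_i; have [_] := phiP i' lo'; rewrite pp; lia.
  - by move=> pp; have := phi_d i' i'X hi_i'; have [_] := phiP i lo; rewrite pp; lia.
  by move=> pp; have [] := phiP i lo; have [] := phiP i' lo'; rewrite pp => -> _ [] /val_inj.
apply/subset_leq_card/fintype.subsetP => j /imsetP[i iX ->]; rewrite inE.
have [hi_i|lo] := boolP (hi i); last by have [-> _] := phiP i lo.
by rewrite lt0n; apply/eqP => /(h7 _ (ltn_ord _)); have := phi_d i iX hi_i; lia.
Qed.

End Auction.

(** * Timed Hoare rules *)

(** Registers become a list with default 0, so that symbolic execution proceeds by computation. *)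
Definition st (l : seq nat) (m : nat -> nat) : state := State (nth 0 l) m.

Definition runs (c : cmd) (l : seq nat) (m : nat -> nat) (t : nat)
    (Q : seq nat -> (nat -> nat) -> Prop) :=
  exists t' l' m', [/\ exec c (st l m) t' (st l' m'), t' <= t & Q l' m'].

Lemma runs_weaken c l m t t' (Q Q' : seq nat -> (nat -> nat) -> Prop) :
  runs c l m t Q -> t <= t' -> (forall l m, Q l m -> Q' l m) -> runs c l m t' Q'.
Proof.
move=> [t1 [l1 [m1 [ex le q]]]] tt H.
by exists t1, l1, m1; split; [| exact: leq_trans tt | exact: H].
Qed.

Lemma runs_seq c1 c2 l m t1 t2 Q1 Q :
  runs c1 l m t1 Q1 -> (forall l m, Q1 l m -> runs c2 l m t2 Q) ->
  runs (CSeq c1 c2) l m (t1 + t2) Q.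
Proof.
move=> [t [l1 [m1 [ex le q]]]] /(_ _ _ q) [t' [l2 [m2 [ex' le' q']]]].
by exists (t + t'), l2, m2; split; [exact: exec_seq ex ex' | exact: leq_add |].
Qed.

Fixpoint loop_free (c : cmd) : bool :=
  match c with
  | CWhile _ _ => false
  | CSeq c1 c2 | CIf _ c1 c2 => loop_free c1 && loop_free c2
  | _ => true
  end.

Fixpoint cmd_cost (c : cmd) : nat :=
  match c with
  | CSkip => 1
  | CSetReg _ e => (expr_cost e).+1
  | CSetMem e1 e2 => (expr_cost e1 + expr_cost e2).+1
  | CSeq c1 c2 => cmd_cost c1 + cmd_cost c2
  | CIf e c1 c2 => (expr_cost e + maxn (cmd_cost c1) (cmd_cost c2)).+1
  | CWhile _ _ => 0
  end.

(** A weakest precondition that unfolds by computation. The value [False] on a loop rules out any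
    execution that meets one. *)
Fixpoint after (c : cmd) (l : seq nat) (m : nat -> nat)
    (Q : seq nat -> (nat -> nat) -> Prop) : Prop :=
  match c with
  | CSkip => Q l m
  | CSetReg r e => Q (set_nth 0 l r (eval (st l m) e)) m
  | CSetMem e1 e2 => Q l (upd m (eval (st l m) e1) (eval (st l m) e2))
  | CSeq c1 c2 => after c1 l m (fun l m => after c2 l m Q)
  | CIf e c1 c2 => if eval (st l m) e != 0 then after c1 l m Q else after c2 l m Q
  | CWhile _ _ => False
  end.

Lemma upd_set_nth (l : seq nat) r v : upd (nth 0 l) r v = nth 0 (set_nth 0 l r v).
Proof. by apply/funext => i; rewrite nth_set_nth. Qed.

Lemma runs_loop_free c l m Q : after c l m Q -> runs c l m (cmd_cost c) Q.
Proof.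
elim: c l m Q => [|r e|e1 e2|c1 IH1 c2 IH2|e c1 IH1 c2 IH2|e c _] l m Q //=.
- by exists 1, l, m; split=> //; exact: exec_skip.
- exists (expr_cost e).+1, (set_nth 0 l r (eval (st l m) e)), m; split=> //.
  by rewrite {2}/st -upd_set_nth; exact: exec_setreg.
- exists (expr_cost e1 + expr_cost e2).+1, l, (upd m (eval (st l m) e1) (eval (st l m) e2)).
  by split=> //; exact: exec_setmem.
- by move/IH1 => H; apply: runs_seq H _ => l1 m1 /IH2.
move=> H.
have [t [l' [m' [ex le q]]]] :
    runs (if eval (st l m) e != 0 then c1 else c2) l m (maxn (cmd_cost c1) (cmd_cost c2)) Q.
  case: ifP H => _ H.
    by apply: runs_weaken (IH1 _ _ _ H) _ _; rewrite ?leq_maxl.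
  by apply: runs_weaken (IH2 _ _ _ H) _ _; rewrite ?leq_maxr.
exists (expr_cost e + t).+1, l', m'; split=> //; last by rewrite ltnS leq_add2l.
exact: exec_if.
Qed.

(** [V] bounds the number of turns, each paying for a test and a body; the last summand pays for the
    failing test. *)
Lemma runs_while e c (Inv : seq nat -> (nat -> nat) -> Prop)
    (V : seq nat -> (nat -> nat) -> nat) t l m :
  (forall l m, Inv l m -> eval (st l m) e != 0 ->
     runs c l m t (fun l' m' => Inv l' m' /\ V l' m' < V l m)) ->
  Inv l m ->
  runs (CWhile e c) l m (V l m * (expr_cost e + t).+1 + (expr_cost e).+1)
    (fun l m => Inv l m /\ eval (st l m) e = 0).
Proof.
move=> body; move: {2}(V l m) (leqnn (V l m)) => v; elim: v l m => [|v IH] l m Vv I.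
all: have [e0|e0] := eqVneq (eval (st l m) e) 0.
1,3: by exists (expr_cost e).+1, l, m; split=> //; [exact: exec_while_stop | exact: leq_addl].
all: have [t1 [l1 [m1 [ex1 le1 [I1 V1]]]]] := body l m I e0.
  by move: V1 Vv; lia.
have [|t2 [l2 [m2 [ex2 le2 q]]]] := IH l1 m1 _ I1; first by move: V1 Vv; lia.
exists (expr_cost e + t1 + t2).+1, l2, m2; split=> //.
  by apply: exec_while_step ex1 ex2; exact/eqP.
have : (V l1 m1).+1 * (expr_cost e + t).+1 <= V l m * (expr_cost e + t).+1.
  by rewrite leq_mul2r V1 orbT.
by rewrite mulSn; lia.
Qed.

Definition CFor (r : nat) (e : expr) (c : cmd) : cmd :=
  CSeq (CSetReg r (EConst 0))
    (CWhile (ELt (EReg r) e) (CSeq c (CSetReg r (EAdd (EReg r) (EConst 1))))).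

(** Per turn, 7 covers the increment (4), the comparison around [e] (2) and the loop step (1). The
    final 5 covers the initialization (2) and the overhead of the failing test (3). *)
Lemma runs_for r e c N t (Inv : nat -> seq nat -> (nat -> nat) -> Prop) l m :
  Inv 0 (set_nth 0 l r 0) m ->
  (forall k l m, Inv k l m -> nth 0 l r = k /\ eval (st l m) e = N) ->
  (forall k l m, k < N -> Inv k l m ->
     runs c l m t (fun l m => Inv k.+1 (set_nth 0 l r (nth 0 l r + 1)) m)) ->
  runs (CFor r e c) l m (N * (t + expr_cost e + 7) + expr_cost e + 5) (Inv N).
Proof.
move=> I0 IE body.
pose I l m := exists2 k, k <= N & Inv k l m.
pose V l (m : nat -> nat) := N - nth 0 l r.
have step l1 m1 : I l1 m1 -> eval (st l1 m1) (ELt (EReg r) e) != 0 ->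
    runs (CSeq c (CSetReg r (EAdd (EReg r) (EConst 1)))) l1 m1 (t + 4)
      (fun l' m' => I l' m' /\ V l' m' < V l1 m1).
  move=> [k kN Ik]; have [rk eN] := IE _ _ _ Ik.
  rewrite /= rk eN; case: ltnP => // k_lt _.
  apply: runs_seq (body _ _ _ k_lt Ik) _ => l2 m2 I2.
  apply: (runs_loop_free (c := CSetReg r (EAdd (EReg r) (EConst 1)))) => /=.
  have [rk2 _] := IE _ _ _ I2; split; first by exists k.+1.
  by rewrite /V rk2 rk; lia.
have IN : I (set_nth 0 l r 0) m by exists 0.
have := runs_while step IN.
rewrite /V (IE _ _ _ I0).1 subn0 /= => H.
have set0 : runs (CSetReg r (EConst 0)) l m 2 (fun l' m' => l' = set_nth 0 l r 0 /\ m' = m).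
  by apply: (runs_loop_free (c := CSetReg r (EConst 0))).
apply: (runs_weaken (runs_seq set0 _)).
- by move=> _ _ [-> ->]; exact: H.
- by rewrite /=; lia.
move=> l1 m1 [[k kN Ik]]; have [rk eN] := IE _ _ _ Ik.
rewrite /= rk eN; case: ltnP => // Nk _.
by have -> : N = k by apply/eqP; rewrite eqn_leq Nk kN.
Qed.

Lemma runs_seq_le c1 c2 l m t1 t2 t Q1 Q :
  runs c1 l m t1 Q1 -> (forall l m, Q1 l m -> runs c2 l m t2 Q) ->
  t1 + t2 <= t -> runs (CSeq c1 c2) l m t Q.
Proof. by move=> H1 H2 le; apply: runs_weaken (runs_seq H1 H2) le _. Qed.

Lemma runs_block c1 c l m t t' Q :
  after c1 l m (fun l m => runs c l m t Q) -> cmd_cost c1 + t <= t' ->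
  runs (CSeq c1 c) l m t' Q.
Proof. by move=> /runs_loop_free H le; apply: runs_seq_le H _ le. Qed.

Lemma runs_last c l m t Q : after c l m Q -> cmd_cost c <= t -> runs c l m t Q.
Proof. by move=> /runs_loop_free H le; apply: runs_weaken H le _. Qed.

Lemma runs_for_le r e c N t t' (Inv : nat -> seq nat -> (nat -> nat) -> Prop)
    (Q : seq nat -> (nat -> nat) -> Prop) l m :
  Inv 0 (set_nth 0 l r 0) m ->
  (forall k l m, Inv k l m -> nth 0 l r = k /\ eval (st l m) e = N) ->
  (forall k l m, k < N -> Inv k l m ->
     runs c l m t (fun l m => Inv k.+1 (set_nth 0 l r (nth 0 l r + 1)) m)) ->
  (forall l m, Inv N l m -> Q l m) ->
  N * (t + expr_cost e + 7) + expr_cost e + 5 <= t' ->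
  runs (CFor r e c) l m t' Q.
Proof. by move=> I0 IE body IQ le; apply: runs_weaken (runs_for I0 IE body) le IQ. Qed.

(** * The program *)

Lemma cell_eq n i j i' j' : j < n -> j' < n ->
  (i * n + j == i' * n + j') = (i == i') && (j == j').
Proof.
move=> jn j'n; apply/eqP/andP => [E|[/eqP -> /eqP ->] //].
have n0 : 0 < n by lia.
have := congr1 (fun a => a %/ n) E; have := congr1 (fun a => a %% n) E.
by rewrite !modnMDl !divnMDl // !divn_small // !addn0 !modn_small // => -> ->.
Qed.

Lemma cell_lt n k i j : i < k -> j < n -> i * n + j < k * n.
Proof.
move=> ik jn; apply: (@leq_trans (i.+1 * n)); first by rewrite mulSn; lia.
by rewrite leq_mul2r ik orbT.
Qed.

Lemma upd_cell n (m : nat -> nat) b i j i' j' v : j < n -> j' < n ->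
  upd m (b + (i * n + j)) v (b + (i' * n + j')) =
  if (i' == i) && (j' == j) then v else m (b + (i' * n + j')).
Proof. by move=> jn j'n; rewrite /upd eqn_add2l cell_eq. Qed.

Lemma upd_ne (m : nat -> nat) a v a' : a' <> a -> upd m a v a' = m a'.
Proof. by rewrite /upd; case: eqP. Qed.

Local Notation "c1 ;; c2" := (CSeq c1 c2) (at level 95, right associativity).
Local Notation size_ := (EReg 0).
Local Notation adj_ := (EReg 1).
Local Notation clo_ := (EReg 2).
Local Notation rep_ := (EReg 3).
Local Notation price_ := (EReg 4).
Local Notation mate_ := (EReg 5).
Local Notation cols_ := (EReg 6).

(* Memory from address [n * n] on: the transposed matrix and then its closure, so
   that together they form a matrix with [n + n] rows, one per column of the
   matching problem; then [n] flags for the representatives, [n + n] prices and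
   [n + n] owners.  Registers 0 to 6 hold the sizes and base addresses. *)
Local Notation frame n a b c d e f g :=
  [:: n; n * n; n * n + n * n; n * n + n * n + n * n; n * n + n * n + n * n + n;
      n * n + n * n + n * n + n + (n + n); n + n; a; b; c; d; e; f; g].

Definition framed n (l : seq nat) :=
  exists a b c d e f g, l = frame n a b c d e f g.

(** For want of multiplication, [n * n] is accumulated by [n] additions. *)
Definition init_bases : cmd :=
  CFor 7 size_ (CSetReg 1 (EAdd adj_ size_));;
  CSetReg 2 (EAdd adj_ adj_);;
  CSetReg 3 (EAdd clo_ adj_);;
  CSetReg 4 (EAdd rep_ size_);;
  CSetReg 6 (EAdd size_ size_);;
  CSetReg 5 (EAdd price_ cols_).

Lemma init_bases_runs n m :
  runs init_bases [:: n; 0; 0; 0; 0; 0; 0; 0; 0; 0; 0; 0; 0; 0] m (n * 12 + 26)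
    (fun l m' => framed n l /\ m' = m).
Proof.
apply: (runs_seq_le (t1 := n * 12 + 6) (t2 := 20) (Q1 := fun l m' =>
    l = [:: n; n * n; 0; 0; 0; 0; 0; n; 0; 0; 0; 0; 0; 0] /\ m' = m)); last by lia.
  apply: (runs_for_le (N := n) (t := 4) (Inv := fun k l m' =>
    l = [:: n; k * n; 0; 0; 0; 0; 0; k; 0; 0; 0; 0; 0; 0] /\ m' = m)) => //.
  - by move=> k l m1 [-> _].
  - move=> k l m1 kn [-> ->]; apply: runs_last => //=.
    by rewrite mulSn addnC addn1.
  by rewrite /=; lia.
move=> l m1 [-> ->]; apply: runs_last => //=.
by split=> //; exists n, 0, 0, 0, 0, 0, 0.
Qed.

(** Register 10 runs through the cells in row-major order and register 11 through the transposed
    ones. Adding the diagonal makes the second copy reflexive; its diagonal entries may equal 2. *)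
Definition copy_input : cmd :=
  CSetReg 10 (EConst 0);;
  CFor 8 size_ (
    CSetReg 11 (EAdd adj_ (EReg 8));;
    CFor 9 size_ (
      CSetMem (EReg 11) (EMem (EReg 10));;
      CSetMem (EAdd clo_ (EReg 10)) (EAdd (EMem (EReg 10)) (EEq (EReg 8) (EReg 9)));;
      CSetReg 10 (EAdd (EReg 10) (EConst 1));;
      CSetReg 11 (EAdd (EReg 11) size_))).

Definition copied n (m0 : nat -> nat) (P : nat -> nat -> bool) (m : nat -> nat) :=
  [/\ forall a, a < n * n -> m a = m0 a,
      forall i j, i < n -> j < n -> m (n * n + (j * n + i)) = if P i j then m0 (i * n + j) else 0,
      forall i j, i < n -> j < n -> m (n * n + n * n + (i * n + j)) =
        if P i j then m0 (i * n + j) + (i == j) else 0 &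
      forall a, n * n + n * n + n * n <= a -> m a = 0].

Lemma copied_eq n m0 P P' m : (forall i j, i < n -> j < n -> P i j = P' i j) ->
  copied n m0 P m -> copied n m0 P' m.
Proof.
move=> PP [h1 h2 h3 h4]; split=> // i j ni nj.
  by rewrite h2 // PP.
by rewrite h3 // PP.
Qed.

Lemma copy_input_runs n l m : framed n l -> (forall a, n * n <= a -> m a = 0) ->
  runs copy_input l m (n * (n * 40 + 30) + 20)
    (fun l' m' => framed n l' /\ copied n m (fun _ _ => true) m').
Proof.
move=> [a [b [c [d [e [f [g ->]]]]]]] m0.
apply: (runs_block (t := n * (n * 40 + 30) + 10)) => //=; last by lia.
apply: (runs_for_le (N := n) (t := n * 40 + 20) (Inv := fun k l m' =>
    (exists c e, l = frame n a k c (k * n) e f g) /\ copied n m (fun i j => i < k) m')).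
- split; first by exists c, e.
  by split=> // [i j ni nj|i j ni nj|x xn]; rewrite ?ltn0 m0 //; lia.
- by move=> k l1 m1 [[c1 [e1 ->]] _].
- move=> k l1 m1 kn [[c1 [e1 ->]] cm].
  apply: (runs_block (t := n * 40 + 10)) => //=; last by lia.
  apply: (runs_for_le (N := n) (t := 27) (Inv := fun j l m' =>
      l = frame n a k j (k * n + j) (n * n + (j * n + k)) f g /\
      copied n m (fun i j' => (i < k) || (i == k) && (j' < j)) m')) => //=.
  + split; first by rewrite mul0n addn0 add0n.
    by apply: copied_eq cm => i j _ _; rewrite ltn0 andbF orbF.
  + by move=> j l2 m2 [-> _].
  + move=> j l2 m2 jn [-> [h1 h2 h3 h4]]; apply: runs_last => //=.
    have kj := cell_lt kn jn; have jk := cell_lt jn kn.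
    split; first by congr [:: _; _; _; _; _; _; _; _; _; _; _; _; _; _]; rewrite ?mulSn; lia.
    split=> [x xn|i j' ni nj'|i j' ni nj'|x xn].
    * by rewrite !upd_ne ?h1 //; lia.
    * have lt := cell_lt nj' ni.
      rewrite upd_ne; last by lia.
      rewrite upd_cell // h1 // h2 //; have [/andP[/eqP -> /eqP ->]|] := boolP (_ && _).
        by rewrite eqxx ltnS leqnn orbT.
      by move=> ne; congr (if _ then _ else _); lia.
    * have lt := cell_lt ni nj'; rewrite upd_cell // upd_ne ?h1 //; last by lia.
      have [/andP[/eqP -> /eqP ->]|ne] := boolP (_ && _).
        by rewrite eqxx ltnS leqnn orbT.
      rewrite upd_ne; last by lia.
      by rewrite h3 //; congr (if _ then _ else _); lia.
    * by rewrite !upd_ne ?h4 //; lia.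
  + move=> l2 m2 [-> cm2]; split.
      exists n, (n * n + (n * n + k)).
      by rewrite /= addn1 [k.+1 * n]mulSn [n + k * n]addnC.
    by apply: copied_eq cm2 => i j ni nj; rewrite nj andbT ltnS orbC -leq_eqVlt.
  by lia.
- move=> l1 m1 [[c1 [e1 ->]] cm]; split; first by exists a, n, c1, (n * n), e1, f, g.
  by apply: copied_eq cm => i j ni nj; rewrite ni.
by rewrite /=; lia.
Qed.

(** Warshall's recursion: connection by a path whose inner vertices lie below [k]. *)
Fixpoint via (M : nat -> nat -> bool) (k : nat) (i j : nat) : bool :=
  if k is k'.+1 then via M k' i j || via M k' i k' && via M k' k' j else M i j.

Lemma via_trans M k i x j : x < k -> via M k i x -> via M k x j -> via M k i j.
Proof.
elim: k i x j => // k IH i x j; rewrite ltnS leq_eqVlt => /orP[/eqP ->|xk] /=.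
  by move=> /orP[ik|/andP[ik _]] /orP[kj|/andP[_ kj]]; rewrite ik kj orbT.
move=> /orP[ix|/andP[ik kx]] /orP[xj|/andP[xk' kj]].
- by rewrite (IH _ _ _ xk ix xj).
- by rewrite (IH _ _ _ xk ix xk') kj orbT.
- by rewrite ik (IH _ _ _ xk kx xj) orbT.
by rewrite ik kj orbT.
Qed.

Definition warshall : cmd :=
  CSetReg 11 clo_;;
  CFor 7 size_ (
    CSetReg 10 clo_;;
    CFor 8 size_ (
      CFor 9 size_ (
        CIf (EMem (EAdd (EReg 10) (EReg 7)))
          (CIf (EMem (EAdd (EReg 11) (EReg 9)))
            (CSetMem (EAdd (EReg 10) (EReg 9)) (EConst 1)) CSkip)
          CSkip);;
      CSetReg 10 (EAdd (EReg 10) size_));;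
    CSetReg 11 (EAdd (EReg 11) size_)).

(** Cells are read only through being nonzero, since a true entry may be stored as 1 or 2. *)
Definition cells n b (m0 : nat -> nat) (M : nat -> nat -> bool) (m : nat -> nat) :=
  (forall i j, i < n -> j < n -> (m (b + (i * n + j)) != 0) = M i j) /\
  (forall a, a < b \/ b + n * n <= a -> m a = m0 a).

Lemma cells_eq n b m0 M M' m : (forall i j, i < n -> j < n -> M i j = M' i j) ->
  cells n b m0 M m -> cells n b m0 M' m.
Proof. by move=> MM [h1 h2]; split=> // i j ni nj; rewrite h1 ?MM. Qed.

Lemma warshall_runs n l m M : framed n l -> cells n (n * n + n * n) m M m ->
  runs warshall l m (n * (n * (n * 23 + 20) + 22) + 10)
    (fun l' m' => framed n l' /\ cells n (n * n + n * n) m (via M n) m').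
Proof.
move=> [a [b [c [d [e [f [g ->]]]]]]] m0.
apply: (runs_block (t := n * (n * (n * 23 + 20) + 22) + 6)) => //=; last by lia.
apply: (runs_for_le (N := n) (t := n * (n * 23 + 20) + 14) (Inv := fun k l m' =>
    (exists b c d, l = frame n k b c d (n * n + n * n + k * n) f g) /\
    cells n (n * n + n * n) m (via M k) m')) => //.
- by split=> //; exists b, c, d; rewrite mul0n addn0.
- by move=> k l1 m1 [[b1 [c1 [d1 ->]]] _].
- move=> k l1 m1 kn [[b1 [c1 [d1 ->]]] ck].
  apply: (runs_block (t := n * (n * 23 + 20) + 12)) => //=; last by lia.
  apply: (runs_seq_le (t1 := n * (n * 23 + 20) + 6) (t2 := 4) (Q1 := fun l m' =>
      (exists b c d, l = frame n k b c d (n * n + n * n + k * n) f g) /\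
      cells n (n * n + n * n) m (via M k.+1) m')); last by lia.
    apply: (runs_for_le (N := n) (t := n * 23 + 12) (Inv := fun i l m' =>
      (exists c, l = frame n k i c (n * n + n * n + i * n) (n * n + n * n + k * n) f g) /\
      cells n (n * n + n * n) m (fun i' j' =>
        if i' < i then via M k.+1 i' j' else via M k i' j') m')) => //.
    + split; first by exists c1; rewrite mul0n addn0.
      by apply: cells_eq ck.
    + by move=> i l2 m2 [[c2 ->] _].
    + move=> i l2 m2 ni [[c2 ->] ci].
      apply: (runs_seq_le (t1 := n * 23 + 6) (t2 := 4) (Q1 := fun l m' =>
        l = frame n k i n (n * n + n * n + i * n) (n * n + n * n + k * n) f g /\
        cells n (n * n + n * n) m (fun i' j' =>
          if i' < i.+1 then via M k.+1 i' j' else via M k i' j') m')); last by lia.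
        apply: (runs_for_le (N := n) (t := 15) (Inv := fun j l m' =>
          l = frame n k i j (n * n + n * n + i * n) (n * n + n * n + k * n) f g /\
          cells n (n * n + n * n) m (fun i' j' =>
            if (i' < i) || (i' == i) && (j' < j) then via M k.+1 i' j'
            else via M k i' j') m')) => //.
        * by split=> //; apply: cells_eq ci => i' j' _ _; rewrite ltn0 andbF orbF.
        * by move=> j l3 m3 [-> _].
        * move=> j l3 m3 nj [-> [h1 h2]]; apply: runs_last => //=.
          rewrite -!addnA !(addnA (n * n) (n * n)).
          pose P0 i' j' :=
            if (i' < i) || (i' == i) && (j' < j) then via M k.+1 i' j' else via M k i' j'.
          have {}h1 i' j' : i' < n -> j' < n ->
              (m3 (n * n + n * n + (i' * n + j')) != 0) = P0 i' j'.
            exact: h1.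
          (* Updating in place is sound: row [k] and column [k] do not change during phase [k], so
             reading a cell already updated there gives the same value. *)
          have P0k i' : P0 i' k = via M k i' k.
            by rewrite /P0 /=; case: ifP => // _; case: (via M k i' k).
          have P0kj : P0 k j = via M k k j.
            by rewrite /P0 /=; case: ifP => // _; case: (via M k k j); rewrite ?andbF.
          have out a1 v : a1 < n * n + n * n \/ n * n + n * n + n * n <= a1 ->
              upd m3 (n * n + n * n + (i * n + j)) v a1 = m a1.
            by move=> ha; have lt := cell_lt ni nj; rewrite upd_ne ?h2 //; lia.
          have P0ij : P0 i j = via M k i j by rewrite /P0 ltnn eqxx ltnn.
          have step (v : bool) : v = via M k.+1 i j -> forall i' j', i' < n -> j' < n ->
              (if (i' == i) && (j' == j) then v else P0 i' j') =
              if (i' < i) || (i' == i) && (j' < j.+1) then via M k.+1 i' j' else via M k i' j'.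
            move=> -> i' j' _ _; rewrite /P0 ltnS [j' <= j]leq_eqVlt.
            have [->|/=] := eqVneq i' i; last by [].
            by rewrite ltnn /=; have [->|] := eqVneq j' j.
          have same (v : bool) : m3 (n * n + n * n + (i * n + j)) != 0 = v -> v = via M k.+1 i j ->
              cells n (n * n + n * n) m (fun i' j' =>
               if (i' < i) || (i' == i) && (j' < j.+1) then via M k.+1 i' j' else via M k i' j') m3.
            move=> mv vE; split=> // i' j' ni' nj'; rewrite -(step v) // h1 //.
            by case: ifP => // /andP[/eqP -> /eqP ->]; rewrite -mv h1.
          rewrite h1 // P0k; case: ifP => ik; last first.
            split; first by rewrite addn1.
            by apply: (same _ erefl); rewrite h1 // P0ij /= ik orbF.
          rewrite h1 // P0kj; case: ifP => kj; last first.
            split; first by rewrite addn1.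
            by apply: (same _ erefl); rewrite h1 // P0ij /= kj andbF orbF.
          split; first by rewrite addn1.
          split=> [i' j' ni' nj'|]; last by move=> a1; exact: out.
          rewrite upd_cell // -(step true) /= ?ik ?kj ?orbT //.
          by case: ifP => // _; rewrite h1.
        * move=> l3 m3 [-> cj]; split=> //; apply: cells_eq cj => i' j' ni' nj'.
          by rewrite nj' andbT ltnS orbC -leq_eqVlt.
        by rewrite /=; lia.
      move=> l3 m3 [-> cj]; apply: runs_last => //=; split; last exact: cj.
      by exists n; rewrite addn1 [i.+1 * n]mulSn [n + i * n]addnC (addnA _ (i * n)).
    + move=> l2 m2 [[c2 ->] ci]; split; first by exists n, c2, (n * n + n * n + n * n).
      by apply: cells_eq ci => i j ni nj; rewrite ni.
    by rewrite /=; lia.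
  move=> l2 m2 [[b2 [c2 [d2 ->]]] ck1]; apply: runs_last => //=; split=> //.
  by exists b2, c2, d2; rewrite addn1 [k.+1 * n]mulSn [n + k * n]addnC (addnA _ (k * n)).
- move=> l1 m1 [[b1 [c1 [d1 ->]]] ck]; split=> //.
  by exists n, b1, c1, d1, (n * n + n * n + n * n), f, g.
by rewrite /=; lia.
Qed.

(** * Finding the source components and building their slots *)

Definition least_rep n (M : nat -> nat -> bool) (v : nat) : bool :=
  all (fun u => M v u ==> M u v && (v <= u)) (iota 0 n).

Definition find_reps : cmd :=
  CSetReg 10 clo_;;
  CFor 8 size_ (
    (CSetReg 12 (EConst 1);; CSetReg 11 (EAdd clo_ (EReg 8)));;
    CFor 9 size_ (
      CIf (EMem (EAdd (EReg 10) (EReg 9)))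
        (CIf (EMem (EReg 11)) CSkip (CSetReg 12 (EConst 0));;
         CIf (ELt (EReg 9) (EReg 8)) (CSetReg 12 (EConst 0)) CSkip)
        CSkip;;
      CSetReg 11 (EAdd (EReg 11) size_));;
    CSetMem (EAdd rep_ (EReg 8)) (EReg 12);;
    CSetReg 10 (EAdd (EReg 10) size_)).

Definition flags b (m0 : nat -> nat) (F : nat -> bool) v (m : nat -> nat) :=
  (forall u, u < v -> m (b + u) = F u) /\
  (forall a, a < b \/ b + v <= a -> m a = m0 a).

Lemma find_reps_runs n l m M : framed n l ->
  (forall i j, i < n -> j < n -> (m (n * n + n * n + (i * n + j)) != 0) = M i j) ->
  runs find_reps l m (n * (n * 33 + 35) + 10)
    (fun l' m' => framed n l' /\
       flags (n * n + n * n + n * n) m (least_rep n M) n m').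
Proof.
move=> [a [b [c [d [e [f [g ->]]]]]]] mM.
pose pre v u := all (fun u => M v u ==> M u v && (v <= u)) (iota 0 u).
have preS v u : pre v u.+1 = pre v u && (M v u ==> M u v && (v <= u)).
  by rewrite /pre -addn1 iotaD all_cat /= andbT.
apply: (runs_block (t := n * (n * 33 + 35) + 6)) => //=; last by lia.
apply: (runs_for_le (N := n) (t := n * 33 + 27) (Inv := fun v l m' =>
    (exists c e f, l = frame n a v c (n * n + n * n + v * n) e f g) /\
    flags (n * n + n * n + n * n) m (least_rep n M) v m')) => //.
- split; first by exists c, e, f; rewrite mul0n addn0.
  by split.
- by move=> v l1 m1 [[c1 [e1 [f1 ->]]] _].
- move=> v l1 m1 vn [[c1 [e1 [f1 ->]]] [fl1 fl2]].
  have m1M i j : i < n -> j < n -> (m1 (n * n + n * n + (i * n + j)) != 0) = M i j.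
    by move=> ni nj; have lt := cell_lt ni nj; rewrite fl2 ?mM //; lia.
  apply: (runs_block (t := n * 33 + 18)) => //=; last by lia.
  apply: (runs_seq_le (t1 := n * 33 + 6) (t2 := 12) (Q1 := fun l m' =>
     (exists c e, l = frame n a v c (n * n + n * n + v * n) e (least_rep n M v : nat) g) /\
     m' = m1)); last by lia.
    apply: (runs_for_le (N := n) (t := 25) (Inv := fun u l m' =>
      l = frame n a v u (n * n + n * n + v * n) (n * n + n * n + (u * n + v))
        (pre v u : nat) g /\ m' = m1)) => //.
    + by move=> u l2 m2 [-> _].
    + move=> u l2 m2 un [-> ->]; apply: runs_last => //=.
      rewrite -(addnA (n * n + n * n) (v * n)) !m1M // preS.
      have -> : n * n + n * n + (u * n + v) + n = n * n + n * n + (u.+1 * n + v).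
        by rewrite mulSn; lia.
      rewrite addn1 [v <= u]leqNgt.
      by case: (M v u); case: (M u v); case: (u < v); rewrite ?andbF ?andbT.
    + by move=> l2 m2 [-> ->]; split=> //; exists n, (n * n + n * n + (n * n + v)).
    by rewrite /=; lia.
  move=> l2 m2 [[c2 [e2 ->]] ->]; apply: runs_last => //=; split.
    exists c2, e2, (least_rep n M v).
    by rewrite addn1 [v.+1 * n]mulSn [n + v * n]addnC (addnA _ (v * n)).
  split=> [u|x]; last by move=> xn; rewrite upd_ne ?fl2 //; lia.
  rewrite ltnS leq_eqVlt; have [->|uv /= lt] := eqVneq u v; first by rewrite /upd eqxx.
  by rewrite upd_ne ?fl1 //; move/eqP: uv; lia.
- move=> l1 m1 [[c1 [e1 [f1 ->]]] fl]; split=> //.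
  by exists a, n, c1, (n * n + n * n + n * n), e1, f1, g.
by rewrite /=; lia.
Qed.

(** Erasing the rows of the other vertices turns the closure into the adjacency of the slots, stored
    right after that of the state columns. *)
Definition mask_reps : cmd :=
  CSetReg 10 clo_;;
  CFor 8 size_ (
    CFor 9 size_ (
      CIf (EMem (EAdd rep_ (EReg 8))) CSkip
        (CSetMem (EAdd (EReg 10) (EReg 9)) (EConst 0)));;
    CSetReg 10 (EAdd (EReg 10) size_)).

Lemma mask_reps_runs n l m M F : framed n l -> cells n (n * n + n * n) m M m ->
  (forall v, v < n -> (m (n * n + n * n + n * n + v) != 0) = F v) ->
  runs mask_reps l m (n * (n * 20 + 20) + 10)
    (fun l' m' => framed n l' /\
       cells n (n * n + n * n) m (fun v u => F v && M v u) m').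
Proof.
move=> [a [b [c [d [e [f [g ->]]]]]]] cM mF.
apply: (runs_block (t := n * (n * 20 + 20) + 6)) => //=; last by lia.
apply: (runs_for_le (N := n) (t := n * 20 + 10) (Inv := fun v l m' =>
    (exists c, l = frame n a v c (n * n + n * n + v * n) e f g) /\
    cells n (n * n + n * n) m (fun v' u => ((v' < v) ==> F v') && M v' u) m')) => //.
- split; first by exists c; rewrite mul0n addn0.
  by apply: cells_eq cM => i j _ _; rewrite ltn0.
- by move=> v l1 m1 [[c1 ->] _].
- move=> v l1 m1 vn [[c1 ->] cv].
  apply: (runs_seq_le (t1 := n * 20 + 6) (t2 := 4) (Q1 := fun l m' =>
     (exists c, l = frame n a v c (n * n + n * n + v * n) e f g) /\
     cells n (n * n + n * n) m (fun v' u => ((v' < v.+1) ==> F v') && M v' u) m')); last by lia.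
    apply: (runs_for_le (N := n) (t := 12) (Inv := fun u l m' =>
      l = frame n a v u (n * n + n * n + v * n) e f g /\
      cells n (n * n + n * n) m (fun v' u' =>
        ((v' < v) || (v' == v) && (u' < u) ==> F v') && M v' u') m')) => //.
    + by split=> //; apply: cells_eq cv => i j _ _; rewrite ltn0 andbF orbF.
    + by move=> u l2 m2 [-> _].
    + move=> u l2 m2 un [-> [h1 h2]]; apply: runs_last => //=.
      have lt := cell_lt vn un; rewrite h2 ?mF //; last by lia.
      have [Fv|Fv] := boolP (F v).
        split; first by rewrite addn1.
        split=> // i j ni nj; rewrite h1 //.
        by have [->|] := eqVneq i v; rewrite ?Fv ?implybT.
      rewrite -(addnA (n * n + n * n) (v * n)).
      split; first by rewrite addn1.
      split=> [i j ni nj|x xn]; last by rewrite upd_ne ?h2 //; lia.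
      rewrite upd_cell // [j < u.+1]ltnS [j <= u]leq_eqVlt.
      have [->|ne] := eqVneq i v; last by rewrite /= h1 // (negbTE ne).
      have [->|/= _] := eqVneq j u; first by rewrite ltnn (negbTE Fv).
      by rewrite h1 // eqxx.
    + move=> l2 m2 [-> cu]; split; first by exists n.
      by apply: cells_eq cu => i j ni nj; rewrite nj andbT ltnS orbC -leq_eqVlt.
    by rewrite /=; lia.
  move=> l2 m2 [[c2 ->] cu]; apply: runs_last => //=; split=> //.
  by exists c2; rewrite addn1 [v.+1 * n]mulSn [n + v * n]addnC (addnA _ (v * n)).
- move=> l1 m1 [[c1 ->] cu]; split; first by exists a, n, c1, (n * n + n * n + n * n), e, f, g.
  by apply: cells_eq cu => i j ni nj; rewrite ni.
by rewrite /=; lia.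
Qed.

(* Leaves in register 12 the least price at most [n] of a column adjacent to the
   row bidding in register 8, and in register 13 such a column; register 12 is
   [n + 1] when there is none. *)
Definition scan_columns : cmd :=
  (CSetReg 12 (EAdd size_ (EConst 1));;
   CSetReg 13 (EConst 0);;
   CSetReg 10 (ESub (EAdd adj_ (EReg 8)) (EConst 1)));;
  CFor 9 cols_ (
    CIf (EMem (EReg 10))
      (CIf (ELt (EMem (EAdd price_ (EReg 9))) (EReg 12))
        (CSetReg 12 (EMem (EAdd price_ (EReg 9)));; CSetReg 13 (EReg 9))
        CSkip)
      CSkip;;
    CSetReg 10 (EAdd (EReg 10) size_)).

Definition least_price n (E : nat -> nat -> bool) (d : nat -> nat) i k best b :=
  (best = n.+1 /\ forall j, j < k -> E j i -> n < d j) \/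
  [/\ b < k, E b i, d b = best, best <= n & forall j, j < k -> E j i -> best <= d j].

Lemma scan_columns_runs n r i c d e f g m E :
  (forall j, j < n + n -> (m (n * n + (j * n + i)) != 0) = E j i) ->
  runs scan_columns (frame n r i.+1 c d e f g) m (n * 58 + 20)
    (fun l' m' => m' = m /\ exists c d best b, l' = frame n r i.+1 c d e best b /\
      least_price n E (fun j => m (n * n + n * n + n * n + n + j)) i (n + n) best b).
Proof.
move=> mE.
apply: (runs_block (t := n * 58 + 6)) => //=; last by lia.
apply: (runs_for_le (N := n + n) (t := 21) (Inv := fun k l m' => m' = m /\
    exists best b, l = frame n r i.+1 k (n * n + (k * n + i)) e best b /\
    least_price n E (fun j => m (n * n + n * n + n * n + n + j)) i k best b)) => //.
- split=> //; exists n.+1, 0; split; last by left.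
  by rewrite /= addn1 addnS subn1.
- by move=> k l1 m1 [_ [best [b [-> _]]]].
- move=> k l1 m1 kn [-> [best [b [-> lp]]]]; apply: runs_last => //=.
  have -> : n * n + (k * n + i) + n = n * n + (k.+1 * n + i) by rewrite mulSn; lia.
  rewrite mE //.
  have [Ek|nE] := boolP (E k i); last first.
    split=> //; exists best, b; split; first by rewrite addn1.
    case: lp => [[-> H]|[bk Eb db bn H]]; [left|right].
      split=> // j; rewrite ltnS leq_eqVlt => /orP[/eqP ->|]; [by rewrite (negbTE nE)|exact: H].
    split=> // [|j]; first exact: leqW.
    by rewrite ltnS leq_eqVlt => /orP[/eqP ->|]; [rewrite (negbTE nE)|exact: H].
  have [lt|ge] := ltnP (m (n * n + n * n + n * n + n + k)) best => /=.
    split=> //; exists (m (n * n + n * n + n * n + n + k)), k; split; first by rewrite addn1.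
    right; split=> //.
      by case: lp => [[bE _]|[_ _ _ bn _]]; lia.
    move=> j; rewrite ltnS leq_eqVlt => /orP[/eqP -> //|jk Ej].
    by case: lp => [[bE H]|[_ _ _ bn H]]; have := H j jk Ej; lia.
  split=> //; exists best, b; split; first by rewrite addn1.
  case: lp => [[bE H]|[bk Eb db bn H]]; [left|right].
    by split=> // j; rewrite ltnS leq_eqVlt => /orP[/eqP -> _|]; [lia|exact: H].
  split=> // [|j]; first exact: leqW.
  by rewrite ltnS leq_eqVlt => /orP[/eqP ->|]; [|exact: H].
- move=> l1 m1 [-> [best [b [-> lp]]]]; split=> //.
  by exists (n + n), (n * n + ((n + n) * n + i)), best, b.
by rewrite /=; lia.
Qed.

(** Register 7 counts the rows that have entered; register 8 holds the bidding row plus one, or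
    0. *)
Definition run_auction : cmd :=
  (CSetReg 7 (EConst 0);; CSetReg 8 (EConst 0));;
  CWhile (EAdd (ELt (EReg 7) size_) (EReg 8)) (
    CIf (EReg 8) CSkip (CSetReg 7 (EAdd (EReg 7) (EConst 1));; CSetReg 8 (EReg 7));;
    scan_columns;;
    CIf (ELt (EReg 12) (EAdd size_ (EConst 1)))
      (CSetReg 11 (EMem (EAdd mate_ (EReg 13)));;
       CSetMem (EAdd mate_ (EReg 13)) (EReg 8);;
       CSetMem (EAdd price_ (EReg 13)) (EAdd (EReg 12) (EConst 1));;
       CSetReg 8 (EReg 11))
      (CSetReg 8 (EConst 0))).

Lemma run_auction_runs n l m E : framed n l ->
  (forall j i, j < n + n -> i < n -> (m (n * n + (j * n + i)) != 0) = E j i) ->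
  (forall a, n * n + n * n + n * n + n <= a -> m a = 0) ->
  runs run_auction l m (((n + n) * n.+1 + (n + n)) * (n * 58 + 70) + 20)
    (fun l' m' => [/\ framed n l',
      auction (n + n) n E (fun j => m' (n * n + n * n + n * n + n + j))
        (fun j => m' (n * n + n * n + n * n + n + (n + n) + j)) 0 n &
      forall a, a < n * n + n * n + n * n + n -> m' a = m a]).
Proof.
move=> [a [b [c [d [e [f [g ->]]]]]]] mE m0.
apply: (runs_block (t := ((n + n) * n.+1 + (n + n)) * (n * 58 + 70) + 10)) => //=; last by lia.
pose Inv l m' := exists r cur c d e f g, [/\ l = frame n r cur c d e f g,
   auction (n + n) n E (fun j => m' (n * n + n * n + n * n + n + j))
        (fun j => m' (n * n + n * n + n * n + n + (n + n) + j)) cur r &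
   forall a, a < n * n + n * n + n * n + n -> m' a = m a].
pose total (m' : nat -> nat) := \sum_(j < n + n) m' (n * n + n * n + n * n + n + j).
(* A bid raises the total price, which is at most [(n + n) * n.+1]; giving up clears the flag of the
   bidder; the factor 2 lets an entry pay for the flag it may raise. *)
pose V l m' := (n + n) * n.+1 - total m' + 2 * (n - nth 0 l 7) + (nth 0 l 8 != 0).
have total_le m' mu cur r :
    auction (n + n) n E (fun j => m' (n * n + n * n + n * n + n + j)) mu cur r ->
    total m' <= (n + n) * n.+1.
  move=> A; rewrite -[n + n in X in _ <= X]card_ord -sum_nat_const.
  by apply: leq_sum => j _; exact: (auction_price A (ltn_ord j)).
have body l1 m1 : Inv l1 m1 -> eval (st l1 m1) (EAdd (ELt (EReg 7) size_) (EReg 8)) != 0 ->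
    runs (CIf (EReg 8) CSkip (CSetReg 7 (EAdd (EReg 7) (EConst 1));; CSetReg 8 (EReg 7));;
    scan_columns;;
    CIf (ELt (EReg 12) (EAdd size_ (EConst 1)))
      (CSetReg 11 (EMem (EAdd mate_ (EReg 13)));;
       CSetMem (EAdd mate_ (EReg 13)) (EReg 8);;
       CSetMem (EAdd price_ (EReg 13)) (EAdd (EReg 12) (EConst 1));;
       CSetReg 8 (EReg 11))
      (CSetReg 8 (EConst 0))) l1 m1 (n * 58 + 60)
    (fun l' m' => Inv l' m' /\ V l' m' < V l1 m1).
  move=> [r [cur [c1 [d1 [e1 [f1 [g1 [-> A m1m]]]]]]]] /= go.
  (* [r'] and [i] describe the auction after the optional entry of a new row. *)
  pose r' := if cur == 0 then r.+1 else r; pose i := if cur == 0 then r else cur.-1.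
  have r'n : r' <= n.
    have rn := auction_entered A; rewrite /r'; case: (cur =P 0) go => [->|//].
    by rewrite addn0; case: ltnP.
  have A' : auction (n + n) n E (fun j => m1 (n * n + n * n + n * n + n + j))
        (fun j => m1 (n * n + n * n + n * n + n + (n + n) + j)) i.+1 r'.
    move: A go; rewrite /i /r'; case: (cur =P 0) => [->|c0] A.
      by rewrite addn0; case: ltnP => // rn _; exact: auction_enter.
    by rewrite prednK ?lt0n //; exact/eqP.
  have i_n : i < n by apply: leq_trans r'n; exact: auction_cur A'.
  apply: (runs_block (t := n * 58 + 50)); last by rewrite /=; lia.
  suff main : runs (scan_columns;;
    CIf (ELt (EReg 12) (EAdd size_ (EConst 1)))
      (CSetReg 11 (EMem (EAdd mate_ (EReg 13)));;
       CSetMem (EAdd mate_ (EReg 13)) (EReg 8);;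
       CSetMem (EAdd price_ (EReg 13)) (EAdd (EReg 12) (EConst 1));;
       CSetReg 8 (EReg 11))
      (CSetReg 8 (EConst 0))) (frame n r' i.+1 c1 d1 e1 f1 g1) m1 (n * 58 + 50)
      (fun l' m' => Inv l' m' /\ V l' m' < V (frame n r cur c1 d1 e1 f1 g1) m1).
    move: main; rewrite /= /r' /i; case: (cur =P 0) => [_|/eqP c0]; first by rewrite addn1.
    by rewrite prednK ?lt0n.
  have mE1 j : j < n + n -> (m1 (n * n + (j * n + i)) != 0) = E j i.
    move=> jn; rewrite m1m ?mE //; have := cell_lt jn i_n; rewrite mulnDl; lia.
  apply: (runs_seq_le (t2 := 30) (scan_columns_runs r' c1 d1 e1 f1 g1 mE1)); last by lia.
  move=> l2 m2.
  move=> [-> [c2 [d2 [best [bj [-> lp]]]]]]; apply: runs_last => //=.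
  have Vdec r2 : r' = r2 -> 2 * (n - r2) + 1 <= 2 * (n - r) + (cur != 0).
    by move=> <-; move: go r'n; rewrite /r'; case: (cur =P 0) => [->|_]; lia.
  case: lp => [[-> out]|[bjn Ebj dbj bestn least]].
    rewrite addn1 ltnn /=; split.
      exists r', 0, c2, d2, e1, n.+1, bj; split=> //.
      by apply: (auction_giveup _ A').
    by rewrite /V /=; have := Vdec _ erefl; lia.
  rewrite addn1 ltnS bestn /=.
  set m3 := upd _ _ _.
  have A3 : auction (n + n) n E (fun j => m3 (n * n + n * n + n * n + n + j))
      (fun j => m3 (n * n + n * n + n * n + n + (n + n) + j))
      (m1 (n * n + n * n + n * n + n + (n + n) + bj)) r'.
    have lst j : j < n + n -> E j i -> m1 (n * n + n * n + n * n + n + bj) <=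
      m1 (n * n + n * n + n * n + n + j) by rewrite dbj; exact: least.
    have dbn : m1 (n * n + n * n + n * n + n + bj) <= n by rewrite dbj.
    apply: auction_eq (auction_bid (ltn0Sn _) A' bjn Ebj dbn lst) => j jn.
      rewrite /upd; case: (j =P bj) => [->|jb]; first by rewrite /m3 /upd eqxx addn1 dbj.
      by rewrite /m3 !upd_ne //; lia.
    rewrite /m3 upd_ne; last by lia.
    by rewrite /upd eqn_add2l.
  have tot : total m3 = (total m1).+1.
    rewrite /total (bigD1 (Ordinal bjn)) //= [in RHS](bigD1 (Ordinal bjn)) //= dbj.
    rewrite {1}/m3 /upd eqxx addn1 addSn; congr (_ + _).+1.
    apply: eq_bigr => j /eqP jb.
    have jbn : (j : nat) <> bj by move=> jE; apply: jb; exact: val_inj.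
    by have jn := ltn_ord j; rewrite /m3 !upd_ne //; lia.
  split.
    exists r', (m1 (n * n + n * n + n * n + n + (n + n) + bj)), c2, d2,
      (m1 (n * n + n * n + n * n + n + (n + n) + bj)), best, bj.
    split=> // x xn; rewrite /m3 !upd_ne ?m1m //; lia.
  have := total_le _ _ _ _ A3; have := Vdec _ erefl; rewrite /V tot /=.
  by case: (m1 _ != 0); lia.
have I0 : Inv (frame n 0 0 c d e f g) m.
  exists 0, 0, c, d, e, f, g; split=> //.
  by apply: auction_eq (auction_init (n + n) n E) => j jn; rewrite m0 //; lia.
apply: runs_weaken (runs_while body I0) _ _.
  rewrite /V /= addn0 subn0.
  have : ((n + n) * n.+1 - total m + 2 * n) * (n * 58 + 66) <=
         ((n + n) * n.+1 + (n + n)) * (n * 58 + 70) by apply: leq_mul; lia.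
  by lia.
move=> l1 m1 [[r [cur [c1 [d1 [e1 [f1 [g1 [-> A m1m]]]]]]]] /= stop].
have c0 : cur = 0 by lia.
have rn : r = n.
  by have := auction_entered A; move: stop; case: ltnP => //; lia.
by rewrite c0 rn in A *; split=> //; exists n, 0, c1, d1, e1, f1, g1.
Qed.

(** The answer overwrites the input: all rows are marked, those sold to state columns are unmarked,
    then representatives with an unsold slot are marked. *)
Definition write_output : cmd :=
  CFor 8 size_ (CSetMem (EReg 8) (EConst 1));;
  CFor 9 size_ (
    CIf (EMem (EAdd mate_ (EReg 9)))
      (CSetMem (ESub (EMem (EAdd mate_ (EReg 9))) (EConst 1)) (EConst 0)) CSkip);;
  CFor 8 size_ (
    CIf (EMem (EAdd rep_ (EReg 8)))
      (CIf (EMem (EAdd (EAdd mate_ size_) (EReg 8))) CSkip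
        (CSetMem (EReg 8) (EConst 1)))
      CSkip).

Lemma write_output_runs n l m F mu : framed n l ->
  (forall v, v < n -> (m (n * n + n * n + n * n + v) != 0) = F v) ->
  (forall j, j < n + n -> m (n * n + n * n + n * n + n + (n + n) + j) = mu j) ->
  (forall j, j < n + n -> mu j <= n) ->
  runs write_output l m (n * 80 + 30)
    (fun _ m' => forall i, i < n ->
       m' i = ~~ has (fun j => mu j == i.+1) (iota 0 n) || F i && (mu (n + i) == 0)).
Proof.
move=> [a [b [c [d [e [f [g ->]]]]]]] mF mmu mun.
(* The output occupies the first [n] cells, hence stays clear of the flags and owners stored beyond
   [n * n]. *)
have nn : n <= n * n by case: (n) => // k; rewrite leq_pmulr.
pose free k i := ~~ has (fun j => mu j == i.+1) (iota 0 k).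
have freeS k i : free k.+1 i = free k i && (mu k != i.+1).
  by rewrite /free -[k.+1]addn1 iotaD has_cat /= orbF negb_or.
apply: (runs_seq_le (t1 := n * 11 + 6) (t2 := n * 60 + 20) (Q1 := fun l m' =>
  (exists b, l = frame n a b c d e f g) /\
  (forall i, i < n -> m' i = 1) /\ forall x, n <= x -> m' x = m x)); last by lia.
  apply: (runs_for_le (N := n) (t := 3) (Inv := fun k l m' =>
    l = frame n a k c d e f g /\
    (forall i, i < k -> m' i = 1) /\ forall x, n <= x -> m' x = m x)) => //.
  - by move=> k l1 m1 [-> _].
  - move=> k l1 m1 kn [-> [h1 h2]]; apply: runs_last => //=; split; first by rewrite addn1.
    split=> [i|x nx]; last by rewrite upd_ne ?h2 //; lia.
    by rewrite ltnS leq_eqVlt /upd; case: eqP => //= _; exact: h1.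
  - by move=> l1 m1 [-> H]; split=> //; exists n.
  by rewrite /=; lia.
move=> l1 m1 [[b1 ->] [h1 h2]].
apply: (runs_seq_le (t1 := n * 24 + 6) (t2 := n * 30 + 6) (Q1 := fun l m' =>
  (exists c, l = frame n a b1 c d e f g) /\
  (forall i, i < n -> m' i = free n i) /\ forall x, n <= x -> m' x = m x)); last by lia.
  apply: (runs_for_le (N := n) (t := 16) (Inv := fun k l m' =>
    l = frame n a b1 k d e f g /\
    (forall i, i < n -> m' i = free k i) /\ forall x, n <= x -> m' x = m x)) => //.
  - by move=> k l2 m2 [-> _].
  - move=> k l2 m2 kn [-> [g1 g2]]; apply: runs_last => //=.
    rewrite g2 ?mmu; [|lia|lia].
    have muk := mun k (ltn_addr _ kn).
    have [k0|k0] := eqVneq (mu k) 0; rewrite /=.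
      by split; [rewrite addn1 | split=> // i ni; rewrite g1 // freeS k0 andbT].
    split; first by rewrite addn1.
    split=> [i ni|x nx]; last by rewrite upd_ne ?g2 //; lia.
    rewrite freeS subn1 /upd; case: (i =P (mu k).-1) => [->|ik].
      by rewrite prednK ?lt0n // eqxx andbF.
    by rewrite g1 // (_ : mu k != i.+1) ?andbT //; apply/eqP; lia.
  - by move=> l2 m2 [-> H]; split=> //; exists n.
  by rewrite /=; lia.
move=> l2 m2 [[c2 ->] [g1 g2]].
apply: (runs_for_le (N := n) (t := 20) (Inv := fun k l m' =>
    l = frame n a k c2 d e f g /\
    (forall i, i < n -> m' i = free n i || (i < k) && (F i && (mu (n + i) == 0))) /\
    forall x, n <= x -> m' x = m x)) => //.
- by split=> //; split=> // i ni; rewrite g1 // orbF.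
- by move=> k l3 m3 [-> _].
- move=> k l3 m3 kn [-> [f1 f2]]; apply: runs_last => //=.
  rewrite f2 ?mF //; last by lia.
  rewrite f2; last by lia.
  rewrite -addnA mmu; last by lia.
  have keep : ~~ (F k && (mu (n + k) == 0)) ->
      frame n a (k + 1) c2 d e f g = frame n a k.+1 c2 d e f g /\
      (forall i, i < n -> m3 i = free n i || (i < k.+1) && (F i && (mu (n + i) == 0))) /\
      forall x, n <= x -> m3 x = m x.
    move=> nk; split; first by rewrite addn1.
    split=> // i ni; rewrite f1 // ltnS [i <= k]leq_eqVlt.
    by case: (i =P k) => [->|//]; rewrite (negbTE nk) !andbF.
  have [Fk|Fk] := boolP (F k); last by apply: keep; rewrite negb_and Fk.
  have [k0|k0] := eqVneq (mu (n + k)) 0; rewrite /=; last first.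
    by apply: keep; rewrite negb_and k0 orbT.
  split; first by rewrite addn1.
  split=> [i ni|x nx]; last by rewrite upd_ne ?f2 //; lia.
  rewrite /upd ltnS [i <= k]leq_eqVlt; case: (i =P k) => [->|_]; last exact: f1.
  by rewrite Fk k0 orbT.
- by move=> l3 m3 [_ [f1 _]] i ni; rewrite f1 // ni.
by rewrite /=; lia.
Qed.

Definition min_input_program : cmd :=
  init_bases;; copy_input;; warshall;; find_reps;; mask_reps;; run_auction;; write_output.

Lemma via_mono M k k' i j : k <= k' -> via M k i j -> via M k' i j.
Proof.
elim: k' => [|k' IH]; first by rewrite leqn0 => /eqP ->.
by rewrite leq_eqVlt => /orP[/eqP -> //|/IH H /H] /= ->.
Qed.

Lemma via_reach n (Abar : structural_matrix n n) (M : nat -> nat -> bool) :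
  (forall i j : 'I_n, M i j = Abar i j || (i == j)) ->
  forall i j : 'I_n, via M n i j = reach Abar i j.
Proof.
move=> MA.
have sound k : k <= n -> forall i j : 'I_n, via M k i j -> reach Abar i j.
  elim: k => [|k IH] kn i j /=.
    by rewrite MA => /orP[ij|/eqP ->]; [exact: connect1 | exact: connect0].
  case/orP => [/(IH (ltnW kn)) //|/andP[]].
  move/(IH (ltnW kn) i (Ordinal kn)) => ik /(IH (ltnW kn) (Ordinal kn) j).
  exact: reach_trans ik.
move=> i j; apply/idP/idP; first exact: sound.
(* The diagonal of [M] covers the empty path; a first edge is prepended through its endpoint [z],
   which is below [n]. *)
case/connectP => p; elim: p i => [|z p IH] i /=.
  by move=> _ ->; apply: (via_mono (leq0n _)); rewrite /= MA eqxx orbT.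
move=> /andP[iz zp] /(IH _ zp); apply: via_trans (ltn_ord z) _.
by apply: (via_mono (leq0n _)); rewrite /= MA iz.
Qed.

Lemma least_rep_source n (Abar : structural_matrix n n) (M : nat -> nat -> bool) :
  (forall i j : 'I_n, M i j = reach Abar i j) ->
  forall v : 'I_n, least_rep n M v = source_rep Abar v.
Proof.
move=> MA v; apply/allP/forallP => [H u|H u].
  by have := H u; rewrite mem_iota /= add0n ltn_ord !MA => /(_ isT).
rewrite mem_iota add0n /= => un; have := H (Ordinal un).
by rewrite -!MA.
Qed.

(** The bracketing follows the nesting of the sequence, so every time bound of a composition holds
    by reflexivity. The auction dominates. *)
Definition program_time (n : nat) : nat :=
  (n * 12 + 26) + ((n * (n * 40 + 30) + 20) + ((n * (n * (n * 23 + 20) + 22) + 10) +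
  ((n * (n * 33 + 35) + 10) + ((n * (n * 20 + 20) + 10) +
  ((((n + n) * n.+1 + (n + n)) * (n * 58 + 70) + 20) + (n * 80 + 30)))))).

Lemma program_time_cubic : is_bigO program_time (fun n => n ^ 3).
Proof.
(* From [n = 1] on, every monomial is at most [n ^ 3], and the coefficients add up to 1229. *)
exists 2000, 1 => n n1; rewrite /program_time.
have n12 : n <= n * n by rewrite leq_pmulr.
have n23 : n * n <= n * n * n by rewrite leq_pmulr.
rewrite !expnS expn0 muln1; nia.
Qed.

Lemma min_input_program_runs (R : realType) n (Abar : structural_matrix n n)
    (m0 : nat -> nat) :
  (forall i j : 'I_n, m0 (i * n + j) = Abar i j :> nat) ->
  (forall a, n * n <= a -> m0 a = 0) ->
  runs min_input_program [:: n; 0; 0; 0; 0; 0; 0; 0; 0; 0; 0; 0; 0; 0] m0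
    (program_time n)
    (fun l m => exists J : {set 'I_n}, (forall j : 'I_n, m j = (j \in J) :> nat) /\
       min_dedicated_input R Abar J).
Proof.
move=> mA mz.
apply: (runs_seq_le (init_bases_runs n m0)); last exact: leqnn.
move=> l0 _ [fr0 ->].
apply: (runs_seq_le (copy_input_runs fr0 mz)); last exact: leqnn.
move=> l1 m1 [fr1 [_ adj1 clo1 z1]].
pose M i j := m0 (i * n + j) + (i == j) != 0.
have cM : cells n (n * n + n * n) m1 M m1.
  by split=> // i j ni nj; rewrite clo1.
apply: (runs_seq_le (warshall_runs fr1 cM)); last exact: leqnn.
move=> l2 m2 [fr2 [clo2 out2]].
apply: (runs_seq_le (find_reps_runs fr2 clo2)); last exact: leqnn.
set F := least_rep n (via M n).
move=> l3 m3 [fr3 [rep3 out3]].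
have cV : cells n (n * n + n * n) m3 (via M n) m3.
  by split=> // i j ni nj; have lt := cell_lt ni nj; rewrite out3 ?clo2 //; lia.
have mF v : v < n -> (m3 (n * n + n * n + n * n + v) != 0) = F v.
  by move=> vn; rewrite rep3 //; case: (F v).
apply: (runs_seq_le (mask_reps_runs fr3 cV mF)); last exact: leqnn.
move=> l4 m4 [fr4 [clo4 out4]].
(* State columns come first, read from the transposed input, followed by the slots. *)
pose E j i := if j < n then m0 (i * n + j) != 0 else F (j - n) && via M n (j - n) i.
have mE j i : j < n + n -> i < n -> (m4 (n * n + (j * n + i)) != 0) = E j i.
  move=> jn ni; rewrite /E; case: ltnP => jn'.
    have lt := cell_lt jn' ni.
    by rewrite out4 ?out3 ?out2 ?adj1 //; lia.
  rewrite -clo4 //; last by lia.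
  by have {1}-> : j = n + (j - n) by [lia]; rewrite mulnDl !addnA.
have z4 a : n * n + n * n + n * n + n <= a -> m4 a = 0.
  by move=> ha; rewrite out4 ?out3 ?out2 ?z1 //; lia.
apply: (runs_seq_le (run_auction_runs fr4 mE z4)); last exact: leqnn.
move=> l5 m5 [fr5 A5 out5].
pose mu j := m5 (n * n + n * n + n * n + n + (n + n) + j).
rewrite -/mu in A5.
have mun j : j < n + n -> mu j <= n by exact: (auction_row A5).
have mF5 v : v < n -> (m5 (n * n + n * n + n * n + v) != 0) = F v.
  by move=> vn; rewrite out5 ?out4 ?mF //; lia.
apply: runs_weaken (write_output_runs (mu := mu) fr5 mF5 _ mun) (leqnn _) _ => //.
move=> l6 m6 out6.
have MA (i j : 'I_n) : M i j = Abar i j || (i == j).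
  rewrite /M mA (_ : (i == j :> nat) = (i == j)) //.
  by case: (Abar i j); case: (i == j).
have reachE := via_reach MA.
have repE (v : 'I_n) : F v = source_rep Abar v by exact: least_rep_source.
pose mate (j : 'I_(n + n)) : option 'I_n := if mu j is i.+1 then insub i else None.
have mateE j (i : 'I_n) : (mate j == Some i) = (mu j == i.+1).
  rewrite /mate; case: (mu j) => // k; rewrite eqSS; case: insubP => [k' _ <-|]; first by [].
  by move=> kn; apply/esym/negbTE; apply: contraNneq kn => ->.
have mate_some j : mate j = (0 < mu j) :> bool.
  rewrite /mate; have := mun j (ltn_ord j); case: (mu j) => // k kn.
  by rewrite insubT.
have slotE (j : 'I_(n + n)) (i : 'I_n) : E j i = slot_edge Abar j i.
  rewrite /slot_edge; case: (split_ordP j) => k ->.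
    by rewrite ?(unsplitK (inl _)) /E /= ltn_ord mA; case: (Abar i k).
  by rewrite ?(unsplitK (inr _)) /E /= ltnNge leq_addr /= addKn reachE repE.
exists (chosen_inputs Abar mate); split; last first.
  apply: chosen_optimal.
  - move=> j i /eqP; rewrite mateE => /eqP mj; rewrite -slotE.
    by have := auction_edge A5 (ltn_ord j); rewrite mj => /(_ isT).
  - move=> j j' i /eqP; rewrite mateE => /eqP mj /eqP; rewrite mateE => /eqP mj'.
    apply/val_inj/(auction_inj A5); [exact: ltn_ord | exact: ltn_ord | |].
      by rewrite mj.
    by rewrite mj mj'.
  move=> X h h_inj hE.
  rewrite (_ : [set j | mate j] = [set j : 'I_(n + n) | 0 < mu j]); last first.
    by apply/finset.setP => j; rewrite !inE mate_some.
  by apply: auction_max A5 h_inj _ => i iX; rewrite slotE; exact: hE.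
move=> j; rewrite out6 // inE; congr (nat_of_bool (_ || _)).
  congr (~~ _); apply/hasP/existsP => [[k]|[k]].
    rewrite mem_iota /= add0n => kn mk; exists (Ordinal kn).
    by rewrite mateE.
  by rewrite mateE => mk; exists (val k) => //; rewrite mem_iota /= add0n ltn_ord.
by rewrite repE mate_some /= -eqn0Ngt.
Qed.

Lemma min_dedicated_input_cubic (R : realType) :
  solvable_in_time (@min_dedicated_input R) (fun n => n ^ 3).
Proof.
exists min_input_program, program_time; split; first exact: program_time_cubic.
move=> n Abar [regs0 m0] [/= r0 rz mA mz].
have -> : regs0 = nth 0 [:: n; 0; 0; 0; 0; 0; 0; 0; 0; 0; 0; 0; 0; 0].
  apply/funext => -[|r]; first by rewrite r0.
  by rewrite rz // -[RHS]/(nth 0 (nseq 13 0) r) nth_nseq if_same.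
have [t [l [m [ex le [J [mJ opt]]]]]] := min_input_program_runs R mA mz.
by exists t, (st l m), J; split.
Qed.

Theorem theorem2 (R : realType) :
  (exists k : nat, solvable_in_time (@min_dedicated_input R) (fun n => (n ^ k)%N)) /\
  solvable_in_time (@min_dedicated_input R) (fun n => (n ^ 3)%N).
Proof. by split; [exists 3|]; exact: min_dedicated_input_cubic. Qed.
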